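(* Let $n\ge 1$. For distinct points $a_1,\ldots,a_n\in\mathbf{C}$ consider the system of equations in the unknowns $(x_1,\ldots,x_n)\in\mathbf{C}^n$: $$x_k^2=\sum_{j\neq k}\frac{x_j-x_k}{a_j-a_k},\qquad k=1,\ldots,n.\qquad( * )$$ If all $a_k$ are real, then all solutions $(x_1,\ldots,x_n)$ of $( * )$ are real. Moreover, each solution $(x_1,\ldots,x_n)$ can be analytically continued as a function of the parameters $(a_1,\ldots,a_n)$ in the region $D=\{(a_1,\ldots,a_n)\in\mathbf{R}^n: a_1<a_2<\ldots<a_n\}$; that is, for every $a^0\in D$ and every solution $x^0$ of $( * )$ with parameters $a^0$, there is an analytic function $X$ on $D$ such that $X(a^0)=x^0$ and, for every $a\in D$, $X(a)$ is a solution of $( * )$ with parameters $a$.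
   Context: The sums are over $j\in\{1,\ldots,n\}$ with $j\ne k$ (an empty sum is $0$). A solution is real if all its components $x_k$ are real numbers. *)

(* Defs.v *)
From HB Require Import structures.
From mathcomp Require Import all_boot all_order all_algebra.
From mathcomp Require Import finmap.
From mathcomp Require Import all_classical all_reals topology normedtype.
From mathcomp Require Import complex.
From mathcomp Require Import summability.
Set Implicit Arguments.
Unset Strict Implicit.
Unset Printing Implicit Defensive.
Import Order.TTheory GRing.Theory Num.Theory numFieldNormedType.Exports.
Local Open Scope classical_set_scope.
Local Open Scope ring_scope.

Definition is_solution (F : fieldType) (n : nat) (a x : 'rV[F]_n) : Prop :=
  forall k : 'I_n,
    x 0 k ^+ 2 = \sum_(j < n | j != k) (x 0 j - x 0 k) / (a 0 j - a 0 k).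

Definition ordered_points (R : realType) (n : nat) : set 'rV[R]_n :=
  [set a | forall i j : 'I_n, (i < j)%N -> a 0 i < a 0 j].

Definition complex_point (R : realType) (n : nat) (a : 'rV[R]_n) : 'rV[R[i]]_n :=
  map_mx (real_complex R) a.

Definition power_series_term (R : realType) (n : nat)
    (c : {ffun 'I_n -> nat} -> R[i]) (a b : 'rV[R]_n)
    (m : {ffun 'I_n -> nat}) : R[i]^o :=
  c m * \prod_(i < n) complex_point (b - a) 0 i ^+ m i.

(* The limit along the filter of finite sets of multi-indices is unordered
   summation, which for complex families is the same as absolute convergence.
   The regular module [R[i]^o] carries the norm topology of the complex plane. *)
Definition analytic_at (R : realType) (n : nat) (f : 'rV[R]_n -> R[i])
    (a : 'rV[R]_n) : Prop :=
  exists c : {ffun 'I_n -> nat} -> R[i],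
    \forall b \near a,
      partial_sum (power_series_term c a b) @ totally --> (f b : R[i]^o).

Definition analytic_on (R : realType) (n p : nat) (D : set 'rV[R]_n)
    (f : 'rV[R]_n -> 'rV[R[i]]_p) : Prop :=
  forall (k : 'I_p) (a : 'rV[R]_n), D a -> analytic_at (fun b => f b 0 k) a.

(* Main.v *)
(* For distinct a_1, ..., a_n consider on functions of subsets S of {1, ..., n}, i.e. on a chain
   of n spins 1/2, the operators X_k = N_k + T_k, where N_k flips the k-th spin down and
   T_k = sum_(j <> k) (1 - P_kj) / (a_k - a_j) with P_kj exchanging sites k and j (the Gaudin
   Hamiltonians). The X_k commute and satisfy the system, and products of distinct X_k evaluated
   at the empty set are coordinates; hence every solution is a joint eigenvalue of the X_k. The
   top-level component of the eigenfunction is a joint eigenvector of the T_k, and for real a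
   these are real symmetric, so the solution is real.

   The total sl2 commutes with the T_k and allows to move the eigenvector to subsets of size
   n/2 (rounded down); the Casimir relation expressing sum a_k T_k shows that there the joint
   spectrum is simple and equals the set of solutions. For a generic linear functional xi,
   therefore, the numbers xi(x) over all solutions x are simple roots of a polynomial whose
   coefficients depend polynomially on a; a Newton iteration in a weighted l1 norm of polynomials
   makes them analytic. Since solutions never collide over the convex set D, following a solution
   along segments from a0 is well defined, and locally it coincides with an analytic branch. *)
Require Import Defs.
From HB Require Import structures.
From mathcomp Require Import all_boot all_order all_algebra perm.
From mathcomp Require Import finmap all_classical all_reals topology normedtype.
From mathcomp Require Import complex summability.
From mathcomp Require Import -(notations) mpoly.
From mathcomp Require Import ring lra zify.
Import Order.TTheory GRing.Theory Num.Theory numFieldNormedType.Exports.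
Set Implicit Arguments.
Unset Strict Implicit.
Unset Printing Implicit Defensive.
Local Open Scope ring_scope.

(** * Gaudin Hamiltonians and the operators X_k *)

Section Operators.
Variables (F : numFieldType) (n : nat).
Local Notation fun_set := {ffun {set 'I_n} -> F}.
Implicit Types (f : fun_set) (S : {set 'I_n}) (i j k l m : 'I_n).

(** The quadratic relations reduce every polynomial in the unknowns to squarefree monomials.
    Functions of subsets model the dual of the resulting algebra of dimension 2^n, and X_k is the
    transpose of multiplication by x_k.

    The obstacle is multiplicity. For n = 1 the system reads x^2 = 0, and for real parameters there
    are only as many distinct solutions as subsets of size n/2 (rounded down), fewer than 2^n. So
    the Jacobian of the system degenerates and the implicit function theorem does not apply to the
    system itself; likewise X_1 = N_1 is nilpotent for n = 1. Passing to the T_k on the middle level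
    removes the multiplicity, because every solution occurs there exactly once.

    The price is that only values of linear functionals are roots of a polynomial, and a functional
    is known to separate solutions only at one parameter point. Branches are therefore local at
    first, and a coordinate is recovered as the difference of two separating functionals. *)

Lemma tperm_imset_same S i j : (i \in S) = (j \in S) -> tperm i j @: S = S.
Proof.
move=> ijS; apply/setP => x; rewrite -{1}(tpermK i j x) mem_imset; last exact: perm_inj.
by case: tpermP => [->|->|//]; rewrite ijS.
Qed.

Lemma mem_tperm_imset S i j x : (x \in tperm i j @: S) = (tperm i j x \in S).
Proof. by rewrite -{1}(tpermK i j x) mem_imset //; exact: perm_inj. Qed.

Ltac tperm_cases :=
  rewrite ?permE /=;
  repeat match goal with |- context [?a == ?b] =>
    is_var a; is_var b; case: (a =P b) => ? /= end; congruence.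

Definition swap_op i j f : fun_set := [ffun S : {set 'I_n} => f (tperm i j @: S)].
Fact swap_op_linear i j : linear (swap_op i j).
Proof. by move=> c f g; apply/ffunP => S; rewrite !ffunE. Qed.
HB.instance Definition _ i j :=
  GRing.isLinear.Build F fun_set fun_set _ (swap_op i j) (swap_op_linear i j).

Lemma swap_opC i j : swap_op i j = swap_op j i.
Proof. by rewrite /swap_op tpermC. Qed.

Lemma swap_opii i f : swap_op i i f = f.
Proof. by apply/ffunP => S; rewrite ffunE tperm_imset_same. Qed.

Lemma swap_opK i j f : swap_op i j (swap_op i j f) = f.
Proof.
apply/ffunP => S; rewrite !ffunE; congr (f _); apply/setP => x.
by rewrite !mem_tperm_imset tpermK.
Qed.

Lemma swap_op_comm i j k l f : i != k -> i != l -> j != k -> j != l ->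
  swap_op i j (swap_op k l f) = swap_op k l (swap_op i j f).
Proof.
move=> /eqP ik /eqP il /eqP jk /eqP jl; apply/ffunP => S; rewrite !ffunE.
congr (f _); apply/setP => x; rewrite !mem_tperm_imset; congr (_ \in S).
tperm_cases.
Qed.

Lemma swap_opJ i j k f : i != j -> j != k -> i != k ->
  swap_op i j (swap_op j k f) = swap_op j k (swap_op i k f).
Proof.
move=> /eqP ij /eqP jk /eqP ik; apply/ffunP => S; rewrite !ffunE.
congr (f _); apply/setP => x; rewrite !mem_tperm_imset; congr (_ \in S).
tperm_cases.
Qed.

(* Among three sites two are in the same state, so the antisymmetrizer of three sites vanishes. *)
Lemma antisymmetrizer3_eq0 i j k f : i != j -> j != k -> i != k ->
  f - swap_op i j f - swap_op i k f - swap_op j k f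
    + swap_op i j (swap_op i k f) + swap_op i k (swap_op i j f) = 0.
Proof.
move=> ij jk ik; apply/ffunP => S; rewrite !ffunE.
have kj : k != j by rewrite eq_sym.
have slide p q r : p != q -> q != r -> p != r -> (p \in S) = (q \in S) ->
    tperm p q @: (tperm p r @: S) = tperm q r @: S.
  move=> /eqP pq /eqP qr /eqP pr /(tperm_imset_same (S := S)) e.
  rewrite -{2}e; apply/setP => x; rewrite !mem_tperm_imset; congr (_ \in S).
  tperm_cases.
have slide' p q r : p != q -> q != r -> p != r -> (q \in S) = (r \in S) ->
    tperm p q @: (tperm p r @: S) = tperm p r @: S.
  move=> /eqP pq /eqP qr /eqP pr /(tperm_imset_same (S := S)) e.
  rewrite -{2}e; apply/setP => x; rewrite !mem_tperm_imset; congr (_ \in S).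
  tperm_cases.
have [e|] := eqVneq (i \in S) (j \in S).
  by rewrite (slide i j k) // !(tperm_imset_same e); ring.
have [e _|] := eqVneq (i \in S) (k \in S).
  rewrite (slide i k j) // !(tperm_imset_same e) (tpermC k j); ring.
have [e _ _|] := eqVneq (j \in S) (k \in S).
  by rewrite (slide' i j k) // (slide' i k j) // !(tperm_imset_same e); ring.
by case: (i \in S); case: (j \in S); case: (k \in S).
Qed.

Definition diff_op i j f := f - swap_op i j f.
Fact diff_op_linear i j : linear (diff_op i j).
Proof. by move=> c f g; rewrite /diff_op linearP scalerBr opprD addrACA. Qed.
HB.instance Definition _ i j :=
  GRing.isLinear.Build F fun_set fun_set _ (diff_op i j) (diff_op_linear i j).

Lemma diff_opC i j : diff_op i j = diff_op j i.
Proof. by rewrite /diff_op swap_opC. Qed.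

Lemma diff_opii i f : diff_op i i f = 0.
Proof. by rewrite /diff_op swap_opii subrr. Qed.

Lemma diff_op_idem i j f : diff_op i j (diff_op i j f) = diff_op i j f *+ 2.
Proof. by rewrite /diff_op linearB /= swap_opK opprB mulr2n addrA. Qed.

(** The vanishing antisymmetrizer, rewritten for 1 - P. The term [diff_op j k], free of the common
    site i, is what later accounts for the other unknowns on the right-hand side of the system. *)
Lemma diff_op_anticomm i j k f : i != j -> j != k -> i != k ->
  diff_op i j (diff_op i k f) + diff_op i k (diff_op i j f) =
  diff_op i j f + diff_op i k f - diff_op j k f.
Proof.
move=> ij jk ik; have := antisymmetrizer3_eq0 f ij jk ik.
rewrite /diff_op !linearB /=; move=> /ffunP e; apply/ffunP => S; move: (e S).
rewrite !ffunE => {}e; apply/eqP; rewrite -subr_eq0; apply/eqP; rewrite -e; ring.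
Qed.

Lemma diff_op_commutator i j k l f :
  diff_op i j (diff_op k l f) - diff_op k l (diff_op i j f) =
  swap_op i j (swap_op k l f) - swap_op k l (swap_op i j f).
Proof. by rewrite /diff_op !linearB /=; apply/ffunP => S; rewrite !ffunE; ring. Qed.

Variable a : 'I_n -> F.
Hypothesis a_inj : injective a.

(* Since 0^-1 = 0, gap_inv i i = 0 and sums may run over all indices. *)
Definition gap_inv i j : F := (a i - a j)^-1.

Lemma gap_inv_anti i j : gap_inv j i = - gap_inv i j.
Proof. by rewrite /gap_inv -opprB invrN. Qed.

Lemma gap_invii i : gap_inv i i = 0.
Proof. by rewrite /gap_inv subrr invr0. Qed.

Lemma gap_neq0 i j : i != j -> a i - a j != 0.
Proof. by move=> ij; rewrite subr_eq0 (inj_eq a_inj). Qed.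

(** The Arnold relation, that is, a partial fraction decomposition. *)
Lemma gap_inv_arnold i j k : i != j -> j != k -> i != k ->
  gap_inv k i * gap_inv i j + gap_inv k j * gap_inv j i = gap_inv k i * gap_inv k j.
Proof.
move=> ij jk ik; rewrite (gap_inv_anti i j) /gap_inv; field.
by rewrite !gap_neq0 // eq_sym.
Qed.

Definition gaudin_op k f : fun_set := \sum_j gap_inv k j *: diff_op k j f.
Fact gaudin_op_linear k : linear (gaudin_op k).
Proof.
move=> c f g; rewrite /gaudin_op scaler_sumr -big_split /=; apply: eq_bigr => j _.
by rewrite linearP scalerDr !scalerA mulrC.
Qed.
HB.instance Definition _ k :=
  GRing.isLinear.Build F fun_set fun_set _ (gaudin_op k) (gaudin_op_linear k).

Lemma sum_offdiag_sym_eq0 (k : 'I_n) (G : 'I_n -> 'I_n -> fun_set) :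
  (forall i j, i != j -> j != k -> i != k -> G i j + G j i = 0) ->
  \sum_(i | i != k) \sum_(j | (j != k) && (j != i)) G i j = 0.
Proof.
move=> G0; set s := LHS.
have : s + s = 0.
  rewrite {2}/s (exchange_big_dep (fun j => j != k)) /=; last by move=> i j _ /andP[].
  transitivity (\sum_(i | i != k) \sum_(j | (j != k) && (j != i)) (G i j + G j i)).
    rewrite [RHS](eq_bigr (fun i => (\sum_(j | (j != k) && (j != i)) G i j) +
       \sum_(j | (j != k) && (j != i)) G j i)); last by move=> i _; rewrite big_split.
    rewrite big_split /=; congr (s + _); apply: eq_bigr => i ik.
    by apply: eq_bigl => j; rewrite ik /= (eq_sym i).
  by rewrite big1 // => i ik; apply: big1 => j /andP[jk ji]; rewrite G0 // eq_sym.
by move/eqP; rewrite -mulr2n -scaler_nat scaler_eq0 pnatr_eq0 => /eqP.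
Qed.

(** The T_k alone already satisfy the system. This is why the eigenvalues of the T_k are again
    solutions. *)
Lemma gaudin_op_sqr k f :
  gaudin_op k (gaudin_op k f) = \sum_j gap_inv k j *: (gaudin_op k f - gaudin_op j f).
Proof.
(* [G i j] is the difference of the (i, j) terms of both sides. Its mixed terms cancel in pairs by
   the Arnold relation and the anticommutator. *)
pose G i j := gap_inv k i *: diff_op k i (gap_inv k j *: diff_op k j f)
  - gap_inv k i *: (gap_inv k j *: diff_op k j f - gap_inv i j *: diff_op i j f).
have GE i j : G i j = (gap_inv k i * gap_inv k j) *: (diff_op k i (diff_op k j f) - diff_op k j f)
    + (gap_inv k i * gap_inv i j) *: diff_op i j f.
  have scaleE (c1 c2 c3 : F) (u v w : fun_set) : c1 *: (c2 *: u) - c1 *: (c2 *: v - c3 *: w)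
      = (c1 * c2) *: (u - v) + (c1 * c3) *: w by apply/ffunP => S; rewrite !ffunE /GRing.scale /=; ring.
  by rewrite /G linearZ scaleE.
apply/eqP; rewrite -subr_eq0; apply/eqP; transitivity (\sum_i \sum_j G i j).
  rewrite {1}/gaudin_op -sumrB; apply: eq_bigr => i _.
  rewrite {1}/gaudin_op linear_sum scaler_sumr /= [gaudin_op k f]/gaudin_op.
  by rewrite -sumrB scaler_sumr -sumrB.
rewrite (bigD1 k) //= big1 ?add0r; last first.
  by move=> j _; rewrite GE gap_invii !mul0r !scale0r addr0.
rewrite -[RHS](@sum_offdiag_sym_eq0 k G); last first.
  move=> i j ij jk ik; rewrite !GE (mulrC (gap_inv k j) (gap_inv k i)) (diff_opC j i).
  have cancel (p q r : F) (u u' v v' w : fun_set) : u + u' = v + v' - w -> q + r = p ->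
      p *: (u - v') + q *: w + (p *: (u' - v) + r *: w) = 0.
    move=> /(canRL (addrK _)) -> <-.
    by apply/ffunP => S; rewrite !ffunE /GRing.scale /=; ring.
  by apply: cancel; rewrite ?gap_inv_arnold // diff_op_anticomm // eq_sym.
(* For fixed i the two terms left over, j = k and j = i, cancel: since (1 - P)^2 = 2 (1 - P), one
   copy of 1 - P survives at j = i, with the opposite coefficient. *)
apply: eq_bigr => i ik; rewrite (bigD1 k) //= (bigD1 i) //= !GE.
rewrite !gap_invii diff_opii !mulr0 !scale0r add0r addr0 diff_op_idem mulr2n addrK.
by rewrite (gap_inv_anti k i) mulrN (diff_opC i k) scaleNr addrA addNr add0r.
Qed.

Lemma gaudin_op_comm k l f : gaudin_op k (gaudin_op l f) = gaudin_op l (gaudin_op k f).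
Proof.
have [->//|kl] := eqVneq k l.
pose A i j := (gap_inv k i * gap_inv l j) *:
  (swap_op k i (swap_op l j f) - swap_op l j (swap_op k i f)).
apply/eqP; rewrite -subr_eq0; apply/eqP; transitivity (\sum_i \sum_j A i j).
  have E p q : gaudin_op p (gaudin_op q f) =
      \sum_i \sum_j (gap_inv p i * gap_inv q j) *: diff_op p i (diff_op q j f).
    rewrite {1}/gaudin_op; apply: eq_bigr => i _.
    rewrite /gaudin_op linear_sum scaler_sumr /=; apply: eq_bigr => j _.
    by rewrite linearZ scalerA.
  rewrite !E [X in _ - X]exchange_big -sumrB; apply: eq_bigr => i _.
  rewrite -sumrB; apply: eq_bigr => j _; rewrite (mulrC (gap_inv l j)) -scalerBr.
  by rewrite diff_op_commutator.
(* Transpositions commute when they have no site in common, so only pairs meeting in one site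
   survive. They are then grouped by the third site m. *)
have A0 i j : i != l -> j != k -> i != j -> A i j = 0.
  move=> il jk ij; have [->|ik] := eqVneq i k.
    by rewrite /A gap_invii mul0r scale0r.
  have [->|jl] := eqVneq j l; first by rewrite /A gap_invii mulr0 scale0r.
  by rewrite /A swap_op_comm ?subrr ?scaler0 // eq_sym.
have Akl : A l k = 0 by rewrite /A (swap_opC l k) subrr scaler0.
have rowk j : A k j = 0 by rewrite /A gap_invii mul0r scale0r.
have coll i : A i l = 0 by rewrite /A gap_invii mulr0 scale0r.
rewrite (bigD1 l) //= [X in _ + X](eq_bigr (fun i => A i k + A i i)); last first.
  move=> i il; have [->|ik] := eqVneq i k.
    by rewrite big1 ?rowk ?addr0.
  rewrite (bigD1 k) //= (bigD1 i) //= big1 ?addr0 // => j /andP[jk ji].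
  by rewrite A0 // eq_sym.
rewrite [X in X + _](bigD1 l) //= coll add0r -big_split /=.
apply: big1 => m ml; have [->|mk] := eqVneq m k; first by rewrite Akl !rowk !addr0.
have lm : l != m by rewrite eq_sym.
have km : k != m by rewrite eq_sym.
have lk : l != k by rewrite eq_sym.
have e1 := swap_opJ f kl lm km.
have e2 : swap_op k m (swap_op l k f) = swap_op l m (swap_op k m f).
  by rewrite -e1 (swap_opC k m) (swap_opC l k) (swap_opC l m) swap_opJ.
have e3 : swap_op l m (swap_op k l f) = swap_op l k (swap_op k m f).
  by rewrite (swap_opC k l) (swap_opC l m) swap_opJ // (swap_opC m k).
have e4 := swap_opJ f lk km lm.
rewrite /A e1 e2 e3 -e4.
(* The six products at the sites k, l, m have become the two 3-cycles; the Arnold relation makes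
   their coefficients vanish. *)
have c : gap_inv k l * gap_inv l m + gap_inv k m * gap_inv l k = gap_inv k m * gap_inv l m.
  have := gap_inv_arnold km ml kl; rewrite (gap_inv_anti k m) (gap_inv_anti k l).
  by move=> /eqP; rewrite -subr_eq0 => /eqP e; apply/eqP; rewrite -subr_eq0 -e; apply/eqP; ring.
rewrite -c; move: (swap_op l m _) (swap_op l k _) => u v.
by apply/ffunP => S; rewrite !ffunE /GRing.scale /=; ring.
Qed.

Definition lower_op k f : fun_set := [ffun S : {set 'I_n} => if k \in S then 0 else f (k |: S)].
Fact lower_op_linear k : linear (lower_op k).
Proof.
by move=> c f g; apply/ffunP => S; rewrite !ffunE; case: ifP; rewrite ?scaler0 ?addr0.
Qed.
HB.instance Definition _ k :=
  GRing.isLinear.Build F fun_set fun_set _ (lower_op k) (lower_op_linear k).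

Lemma lower_swap_op k j f : lower_op k (swap_op k j f) = swap_op k j (lower_op j f).
Proof.
by apply/ffunP => S; rewrite !ffunE mem_tperm_imset tpermR imsetU1 tpermL.
Qed.

Lemma lower_swap_opD i j k f : i != j -> i != k ->
  lower_op i (swap_op j k f) = swap_op j k (lower_op i f).
Proof.
move=> ij ik; apply/ffunP => S; rewrite !ffunE mem_tperm_imset imsetU1.
by rewrite tpermD 1?eq_sym.
Qed.

(** On two sites, 1 - P projects (up to the factor 2) onto the singlet, which the total lowering N_k
    + N_j annihilates. *)
Lemma lower_swap_op_sym k j f :
  lower_op k (swap_op k j f) + lower_op j (swap_op k j f) = lower_op k f + lower_op j f.
Proof.
apply/ffunP => S; rewrite !ffunE !imsetU1 tpermL tpermR.
have [kS|kS] := boolP (k \in S); have [jS|jS] := boolP (j \in S) => //.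
- have <- : tperm k j @: (j |: S) = k |: tperm k j @: S by rewrite imsetU1 tpermR.
  by rewrite tperm_imset_same // !inE eqxx kS orbT.
- have <- : tperm k j @: (k |: S) = j |: tperm k j @: S by rewrite imsetU1 tpermL.
  by rewrite tperm_imset_same // !inE eqxx jS orbT.
- by rewrite tperm_imset_same 1?addrC // (negbTE kS) (negbTE jS).
Qed.

Lemma lower_op_comm k l f : lower_op k (lower_op l f) = lower_op l (lower_op k f).
Proof.
have [->//|kl] := eqVneq k l; apply/ffunP => S.
rewrite !ffunE !inE finset.setUCA (eq_sym l k) (negbTE kl) /=.
by case: (k \in S); case: (l \in S).
Qed.

Lemma lower_op_sqr k f : lower_op k (lower_op k f) = 0.
Proof. by apply/ffunP => S; rewrite !ffunE !inE eqxx; case: ifP. Qed.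

Definition mult_op k f : fun_set := lower_op k f + gaudin_op k f.
Fact mult_op_linear k : linear (mult_op k).
Proof. by move=> c f g; rewrite /mult_op !linearP scalerDr addrACA. Qed.
HB.instance Definition _ k :=
  GRing.isLinear.Build F fun_set fun_set _ (mult_op k) (mult_op_linear k).

(** Of all terms of T_l only the one with j = k moves the site k. *)
Lemma lower_gaudin_op_commutator k l f : k != l ->
  lower_op k (gaudin_op l f) - gaudin_op l (lower_op k f) =
  gap_inv l k *: swap_op k l (lower_op k f - lower_op l f).
Proof.
move=> kl; rewrite /gaudin_op linear_sum -sumrB (bigD1 k) //= big1 ?addr0; last first.
  move=> j jk; rewrite linearZ /= -scalerBr /diff_op [lower_op k (_ - _)]linearB /=.
  by rewrite lower_swap_opD ?subrr ?scaler0 // eq_sym.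
rewrite linearZ /= -scalerBr /diff_op [lower_op k (_ - _)]linearB /= (swap_opC l k).
rewrite lower_swap_op [swap_op k l (_ - _)]linearB /=.
by congr (_ *: _); rewrite opprB addrC addrA subrK.
Qed.

(** The commutator of N_k with T_l is symmetric in k and l, because both the gap and N_k - N_l
    change sign; so the two cross terms cancel. *)
Lemma mult_op_comm k l f : mult_op k (mult_op l f) = mult_op l (mult_op k f).
Proof.
have [->//|kl] := eqVneq k l.
have e1 := lower_gaudin_op_commutator f kl.
have e2 : lower_op l (gaudin_op k f) - gaudin_op k (lower_op l f) =
    gap_inv l k *: swap_op k l (lower_op k f - lower_op l f).
  rewrite lower_gaudin_op_commutator 1?eq_sym // (gap_inv_anti l k) (swap_opC l k).
  by rewrite -opprB linearN scaleNr scalerN opprK.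
have e : lower_op k (gaudin_op l f) + gaudin_op k (lower_op l f) =
    lower_op l (gaudin_op k f) + gaudin_op l (lower_op k f).
  rewrite -(subrK (gaudin_op l (lower_op k f)) (lower_op k _)) e1 -e2.
  by rewrite addrAC subrK.
rewrite /mult_op ![in LHS]linearD ![in RHS]linearD /= (lower_op_comm k l).
rewrite (gaudin_op_comm k l) 2!addrA -[in LHS](addrA (lower_op _ _)) e.
by rewrite [in LHS]addrA.
Qed.

(** Adding N_k preserves the relation for T_k: N_k squares to 0, and the anticommutator of N_k and
    T_k is exactly the contribution of the N's to the right-hand side. *)
Lemma mult_op_sqr k f :
  mult_op k (mult_op k f) = \sum_j gap_inv k j *: (mult_op k f - mult_op j f).
Proof.
have cross : lower_op k (gaudin_op k f) + gaudin_op k (lower_op k f) =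
    \sum_j gap_inv k j *: (lower_op k f - lower_op j f).
  rewrite /gaudin_op linear_sum -big_split; apply: eq_bigr => j _ /=.
  rewrite linearZ /= -scalerDr; congr (_ *: _); rewrite /diff_op [lower_op k (_ - _)]linearB /=.
  have -> : swap_op k j (lower_op k f) = lower_op j (swap_op k j f).
    by rewrite (swap_opC k j) lower_swap_op.
  rewrite addrACA -opprD lower_swap_op_sym opprD addrA addrK.
  by [].
rewrite /mult_op !linearD /= lower_op_sqr add0r addrA cross gaudin_op_sqr -big_split.
apply: eq_bigr => j _ /=; rewrite -scalerDr; congr (_ *: _).
by rewrite opprD addrACA.
Qed.
End Operators.

(** * From solutions to joint eigenfunctions of the X_k *)

Section Eigenfunction.
Variables (F : numFieldType) (n : nat) (a : 'I_n -> F).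
Hypothesis a_inj : injective a.
Local Notation fun_set := {ffun {set 'I_n} -> F}.
Implicit Types (f g : fun_set) (S T : {set 'I_n}) (i j k l m : 'I_n).

Definition mult_seq (s : seq 'I_n) f := foldr (mult_op a) f s.

Fact mult_seq_linear s : linear (mult_seq s).
Proof. by move=> c f g; elim: s => //= k s ->; rewrite linearP. Qed.
HB.instance Definition _ s :=
  GRing.isLinear.Build F fun_set fun_set _ (mult_seq s) (mult_seq_linear s).

Lemma mult_seq_mult_op s k f : mult_seq s (mult_op a k f) = mult_op a k (mult_seq s f).
Proof. by elim: s => //= l s ->; rewrite mult_op_comm. Qed.

Lemma mult_seq_perm s t f : perm_eq s t -> mult_seq s f = mult_seq t f.
Proof.
elim: s t => [|k s IH] t st; first by move: st; rewrite perm_sym => /perm_nilP ->.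
have /path.splitPr kt : k \in t by rewrite -(perm_mem st) mem_head.
case: kt st => t1 t2; rewrite perm_sym perm_catC /= perm_cons perm_catC perm_sym => /IH /= ->.
by rewrite /mult_seq !foldr_cat /= -!/(mult_seq _ _) mult_seq_mult_op.
Qed.

Lemma card_tperm_imset i j S : #|tperm i j @: S| = #|S|.
Proof. by rewrite card_imset //; exact: perm_inj. Qed.

Lemma mult_op_lowest k f p S : (forall T, (#|T| <= p)%N -> f T = 0) ->
  #|S| = p -> k \notin S -> mult_op a k f S = f (k |: S).
Proof.
move=> f0 Sp kS; rewrite !ffunE (negbTE kS) sum_ffunE big1 ?addr0 // => j _.
by rewrite !ffunE !f0 ?card_tperm_imset ?Sp // subrr scaler0.
Qed.

Lemma gaudin_op_vanish k f p S : (forall T, #|T| = p -> f T = 0) ->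
  #|S| = p -> gaudin_op a k f S = 0.
Proof.
move=> f0 Sp; rewrite sum_ffunE big1 // => j _.
by rewrite !ffunE !f0 ?card_tperm_imset // subrr scaler0.
Qed.

Lemma mult_op_vanish k f p S : (forall T, (#|T| <= p)%N -> f T = 0) ->
  (#|S| < p)%N -> mult_op a k f S = 0.
Proof.
move=> f0 Sp; rewrite !ffunE.
rewrite (@gaudin_op_vanish k f #|S| S) // ?addr0; last first.
  by move=> T TS; rewrite f0 // TS ltnW.
by case: ifP => // kS; rewrite f0 // cardsU1 kS.
Qed.

(** Triangularity: each factor can decrease the level by at most one, and only through N_k. Hence on
    the lowest levels of f the T_k never contribute and the product of X_k acts as a product of
    N_k. *)
Lemma mult_seq_lowest s f p S : uniq s -> (forall T, (#|T| < size s + p)%N -> f T = 0) ->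
  [/\ forall T, (#|T| < p)%N -> mult_seq s f T = 0 &
      #|S| = p -> [disjoint s & S] -> mult_seq s f S = f ([set x in s] :|: S)].
Proof.
elim: s p S => [|k s IH] p S /=.
  by move=> _ f0; split => // _ _; congr (f _); apply/setP => x; rewrite !inE.
move=> /andP[ks us] f0.
have [] := IH p.+1 (k |: S) us; first by move=> T; rewrite addnS; apply: f0.
move=> lo hi; split.
  by move=> T Tp; apply: (@mult_op_vanish _ _ p).
move=> Sp; rewrite disjoint_cons => /andP[kS dS].
rewrite (@mult_op_lowest _ _ p) // hi.
- by congr (f _); apply/setP => x; rewrite !inE orbCA orbA.
- by rewrite cardsU1 kS Sp.
- apply/pred0P => y /=; rewrite !inE; have /= := pred0P dS y.
  by case: eqP => [->|//]; rewrite (negbTE ks).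
Qed.

(** The values at the empty set of squarefree products of the X_k serve as coordinates. By
    triangularity they determine f level by level. *)
Lemma mult_seq_inj f : (forall S, mult_seq (enum S) f finset.set0 = 0) -> f = 0.
Proof.
move=> f0; suff fvan p T : (#|T| < p)%N -> f T = 0.
  by apply/ffunP => T; rewrite ffunE (fvan #|T|.+1).
elim: p T => // p IH T; rewrite ltnS leq_eqVlt => /orP[/eqP Tp|]; last exact: IH.
have := @mult_seq_lowest (enum T) f 0 finset.set0 (enum_uniq _).
rewrite addn0 -cardE Tp => /(_ IH)[_].
rewrite cards0 f0 finset.setU0 => -> //; first by congr (f _); apply/setP => x; rewrite inE mem_enum.
by apply/pred0P => x /=; rewrite [x \in finset.set0]inE andbF.
Qed.

Lemma mult_seq_surj (v : fun_set) : exists f, forall S, mult_seq (enum S) f finset.set0 = v S.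
Proof.
(* Over the regular module [F^o] these functions form a finite-dimensional vector space, where an
   injective endomorphism is invertible. *)
pose W := {ffun {set 'I_n} -> F^o}.
pose Phi (f : W) : W := [ffun S : {set 'I_n} => mult_seq (enum S) (f : fun_set) finset.set0].
have Phi_lin : linear Phi by move=> c f g; apply/ffunP => S; rewrite !ffunE linearP !ffunE.
pose M := GRing.isLinear.Build F W W *:%R Phi Phi_lin.
pose PhiL : {linear W -> W} := HB.pack Phi M.
have : lker (linfun PhiL) == 0%VS.
  apply/lker0P => f g; rewrite !lfunE /= => /ffunP e.
  apply/eqP; rewrite -subr_eq0; apply/eqP; apply: (@mult_seq_inj (f - g : W)) => S.
  by have := e S; rewrite !ffunE linearB !ffunE => ->; rewrite subrr.
move=> /lker0_lfunVK /(_ v) e; exists ((linfun PhiL)^-1%VF v) => S.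
by have /ffunP/(_ S) := e; rewrite lfunE ffunE.
Qed.

Lemma enum_setU1_perm k S : k \notin S -> perm_eq (k :: enum S) (enum (k |: S)).
Proof.
move=> kS; apply: uniq_perm; rewrite /= ?mem_enum ?kS ?enum_uniq // => i.
by rewrite in_cons !mem_enum !inE.
Qed.

Definition gaudin_solution (x : 'I_n -> F) :=
  forall k, x k ^+ 2 = \sum_j gap_inv a k j * (x k - x j).

(** The eigenfunction stands for evaluation at the point x: its coordinates are the values of the
    squarefree monomials at x. *)
Lemma eigenfunction_exists (x : 'I_n -> F) : gaudin_solution x ->
  exists2 f : fun_set, f finset.set0 = 1 & forall k, mult_op a k f = x k *: f.
Proof.
move=> xsol; have [f fE] := mult_seq_surj [ffun S : {set 'I_n} => \prod_(i in S) x i].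
have {}fE S : mult_seq (enum S) f finset.set0 = \prod_(i in S) x i by rewrite fE ffunE.
have mult_seqU1 k S g : k \notin S ->
    mult_seq (enum (k |: S)) g = mult_seq (enum S) (mult_op a k g).
  by move=> kS; rewrite -(mult_seq_perm _ (enum_setU1_perm kS)) mult_seq_mult_op.
have key p : forall S, (#|S| < p)%N -> forall k,
    mult_seq (enum S) (mult_op a k f) finset.set0 = x k * \prod_(i in S) x i.
  elim: p => // p IH S Sp k; have [kS|kS] := boolP (k \in S); last first.
    by rewrite -mult_seqU1 // fE big_setU1.
  have kS' : k \notin S :\ k by rewrite !inE eqxx.
  have S'p : (#|S :\ k| < p)%N by move: Sp; rewrite (cardsD1 k) kS.
  (* When k is in S the operator X_k occurs twice. The same quadratic relation holds for the X's and
     for x, and it leaves only the smaller set without k, to which the induction applies. *)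
  rewrite -(finset.setD1K kS) mult_seqU1 // mult_op_sqr // big_setU1 //= mulrA -expr2 xsol.
  rewrite linear_sum sum_ffunE mulr_suml; apply: eq_bigr => j _.
  by rewrite linearZ linearB !ffunE !IH // /GRing.scale /= -mulrBl mulrA.
exists f; first by have := fE finset.set0; rewrite enum_set0 big_set0.
move=> k; apply/eqP; rewrite -subr_eq0; apply/eqP; apply: mult_seq_inj => S.
by rewrite linearB linearZ !ffunE (key #|S|.+1) // fE /GRing.scale /= subrr.
Qed.

(** All coordinates of a joint eigenfunction are multiples of its value at the empty set. This
    one-dimensionality is the source of the simplicity of the spectrum. *)
Lemma eigenfunction_eq0 (x : 'I_n -> F) f : (forall k, mult_op a k f = x k *: f) ->
  f finset.set0 = 0 -> f = 0.
Proof.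
move=> fX f0; apply: mult_seq_inj => S.
have -> : mult_seq (enum S) f = (\prod_(k <- enum S) x k) *: f.
  elim: (enum S) => [|k s /= ->]; first by rewrite big_nil scale1r.
  by rewrite linearZ /= fX big_cons scalerA mulrC.
by rewrite !ffunE f0 scaler0.
Qed.
End Eigenfunction.

(** * Grading by subset size, total sl2 and the Casimir relation *)

Section Levels.
Variables (F : numFieldType) (n : nat) (a : 'I_n -> F).
Hypothesis a_inj : injective a.
Local Notation fun_set := {ffun {set 'I_n} -> F}.
Local Notation T_ := (gaudin_op a).
Local Notation X_ := (mult_op a).
Implicit Types (f g u v : fun_set) (S T : {set 'I_n}) (i j k : 'I_n) (l m p : nat).

Definition level_part m f : fun_set := [ffun S : {set 'I_n} => if #|S| == m then f S else 0].
Fact level_part_linear m : linear (level_part m).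
Proof.
by move=> c f g; apply/ffunP => S; rewrite !ffunE; case: ifP; rewrite ?scaler0 ?addr0.
Qed.
HB.instance Definition _ m :=
  GRing.isLinear.Build F fun_set fun_set _ (level_part m) (level_part_linear m).

Definition below m f := forall S, (m <= #|S|)%N -> f S = 0.

Lemma level_part_id m f : level_part m (level_part m f) = level_part m f.
Proof. by apply/ffunP => S; rewrite !ffunE; case: (_ == _). Qed.

Lemma level_part_below m f : level_part m f = f -> below m.+1 f.
Proof. by move=> fm S Sm; rewrite -fm ffunE (gtn_eqF Sm). Qed.

Lemma below_level_part m f : below m.+1 f -> level_part m f = 0 -> below m f.
Proof.
move=> fm /ffunP f0 S; rewrite leq_eqVlt => /orP[/eqP mS|]; last exact: fm.
by have := f0 S; rewrite !ffunE -mS eqxx.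
Qed.

Lemma below0 f : below 0 f -> f = 0.
Proof. by move=> f0; apply/ffunP => S; rewrite f0 ?ffunE. Qed.

Lemma level_part_gaudin m k f : level_part m (T_ k f) = T_ k (level_part m f).
Proof.
apply/ffunP => S; rewrite ffunE !sum_ffunE; case: ifPn => Sm; last first.
  by rewrite big1 // => j _; rewrite !ffunE card_tperm_imset (negbTE Sm) subrr scaler0.
by apply: eq_bigr => j _; rewrite !ffunE card_tperm_imset Sm.
Qed.

Lemma level_part_lower m k f : level_part m (lower_op k f) = lower_op k (level_part m.+1 f).
Proof.
apply/ffunP => S; rewrite !ffunE; have [kS|kS] := boolP (k \in S); first by case: ifP.
by rewrite cardsU1 kS eqSS.
Qed.

Lemma gaudin_below m k f : below m f -> below m (T_ k f).
Proof.
move=> f0 S Sm; rewrite sum_ffunE big1 // => j _.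
by rewrite !ffunE !f0 ?card_tperm_imset // subrr scaler0.
Qed.

Lemma lower_below m k f : below m.+1 f -> below m (lower_op k f).
Proof.
by move=> f0 S Sm; rewrite ffunE; case: ifPn => // kS; rewrite f0 // cardsU1 kS.
Qed.

Lemma mult_below m k f : below m f -> below m (X_ k f).
Proof.
move=> f0 S Sm; rewrite /mult_op ffunE (gaudin_below k f0) // addr0.
by apply: (@lower_below m) => // T mT; apply: f0; apply: ltnW.
Qed.

Lemma level_part_mult m k f : below m.+1 f -> level_part m (X_ k f) = T_ k (level_part m f).
Proof.
move=> f0; rewrite /mult_op linearD /= level_part_gaudin -[RHS]add0r; congr (_ + _).
apply/ffunP => S; rewrite ffunE [RHS]ffunE; case: eqP => // Sm.
by rewrite (lower_below k f0) // Sm.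
Qed.

Definition lowering f : fun_set := \sum_k lower_op k f.
Fact lowering_linear : linear lowering.
Proof.
move=> c f g; rewrite /lowering scaler_sumr -big_split; apply: eq_bigr => k _ /=.
by rewrite linearP.
Qed.
HB.instance Definition _ := GRing.isLinear.Build F fun_set fun_set _ lowering lowering_linear.

Lemma level_part_lowering m f : level_part m (lowering f) = lowering (level_part m.+1 f).
Proof. by rewrite linear_sum; apply: eq_bigr => k _; apply: level_part_lower. Qed.

Lemma lowering_level0 f : lowering (level_part 0 f) = 0.
Proof.
apply/ffunP => S; rewrite sum_ffunE big1 ?ffunE // => k _; rewrite !ffunE.
by case: ifPn => // kS; rewrite cardsU1 kS.
Qed.

Definition raise_op (k : 'I_n) f : fun_set :=
  [ffun S : {set 'I_n} => if k \in S then f (S :\ k) else 0].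
Fact raise_op_linear k : linear (raise_op k).
Proof.
by move=> c f g; apply/ffunP => S; rewrite !ffunE; case: ifP; rewrite ?scaler0 ?addr0.
Qed.
HB.instance Definition _ k :=
  GRing.isLinear.Build F fun_set fun_set _ (raise_op k) (raise_op_linear k).

Definition raising f : fun_set := \sum_k raise_op k f.
Fact raising_linear : linear raising.
Proof.
move=> c f g; rewrite /raising scaler_sumr -big_split; apply: eq_bigr => k _ /=.
by rewrite linearP.
Qed.
HB.instance Definition _ := GRing.isLinear.Build F fun_set fun_set _ raising raising_linear.

Lemma level_part_raising m f : level_part m.+1 (raising f) = raising (level_part m f).
Proof.
rewrite linear_sum; apply: eq_bigr => k _; apply/ffunP => S; rewrite !ffunE.
have [kS|kS] := boolP (k \in S); last by case: ifP.
by rewrite (cardsD1 k S) kS add1n eqSS.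
Qed.

(** Exchanging two sites in the same state changes nothing, so only pairs with one site in S and the
    other outside contribute. With b = 1 the sum vanishes, with b = a the gaps cancel. *)
Lemma sum_gaudin_opE (b : 'I_n -> F) f S : (\sum_k b k *: T_ k f) S =
  \sum_(k in S) \sum_(j | j \notin S) (b k - b j) * gap_inv a k j * (f S - f (tperm k j @: S)).
Proof.
pose G k j := b k * gap_inv a k j * (f S - f (tperm k j @: S)).
have G0 k j : (k \in S) = (j \in S) -> G k j = 0.
  by move=> e; rewrite /G tperm_imset_same // subrr mulr0.
transitivity (\sum_k \sum_j G k j).
  rewrite sum_ffunE; apply: eq_bigr => k _; rewrite ffunE sum_ffunE scaler_sumr.
  by apply: eq_bigr => j _; rewrite !ffunE /G /GRing.scale /= mulrA.
rewrite (bigID (mem S)) /=.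
have inE k : k \in S -> \sum_j G k j = \sum_(j | j \notin S) G k j.
  move=> kS; rewrite (bigID (mem S)) /= big1 ?add0r // => j jS; rewrite G0 //.
  by rewrite kS jS.
have outE k : k \notin S -> \sum_j G k j = \sum_(j in S) G k j.
  move=> kS; rewrite (bigID (mem S)) /= [X in _ + X]big1 ?addr0 // => j jS; rewrite G0 //.
  by rewrite (negbTE kS) (negbTE jS).
rewrite (eq_bigr _ inE) (eq_bigr _ outE) [X in _ + X]exchange_big -big_split.
apply: eq_bigr => k kS; rewrite -big_split; apply: eq_bigr => j jS /=.
by rewrite /G (gap_inv_anti a k j) (tpermC j k); ring.
Qed.

Lemma sum_gaudin_op_eq0 f : \sum_k T_ k f = 0.
Proof.
apply/ffunP => S; have := sum_gaudin_opE (fun=> 1) f S.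
under eq_bigr => k _ do rewrite scale1r.
by move=> ->; rewrite ffunE; apply: big1 => k _; apply: big1 => j _; rewrite subrr !mul0r.
Qed.

(** As the T_k sum to 0, total lowering is the sum of the X_k. It therefore commutes with each of
    them. *)
Lemma loweringE f : lowering f = \sum_k X_ k f.
Proof. by rewrite [RHS]big_split /= sum_gaudin_op_eq0 addr0. Qed.

Lemma lowering_mult k f : lowering (X_ k f) = X_ k (lowering f).
Proof.
by rewrite !loweringE linear_sum; apply: eq_bigr => j _; rewrite mult_op_comm.
Qed.

Lemma lowering_gaudin k f : lowering (T_ k f) = T_ k (lowering f).
Proof.
have := lowering_mult k f; rewrite /mult_op linearD /=.
suff -> : lowering (lower_op k f) = lower_op k (lowering f) by move/addrI.
by rewrite linear_sum; apply: eq_bigr => j _; rewrite lower_op_comm.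
Qed.

(** The adjacency operator of the Johnson graphs: neighbours of S arise by exchanging one element
    for one outside. *)
Definition swap_sum f S := \sum_(j in S) \sum_(k | k \notin S) f (tperm j k @: S).

Lemma tperm_imset_exchange (j k : 'I_n) S : j \in S -> k \notin S ->
  tperm j k @: S = k |: S :\ j.
Proof.
move=> jS kS; rewrite -{1}(finset.setD1K jS) imsetU1 tpermL; congr (_ |: _).
by apply: tperm_imset_same; rewrite !inE eqxx (negbTE kS) andbF.
Qed.

(** The gaps cancel, so this combination does not depend on a. It is the Laplacian of the Johnson
    graph, in which S has |S| (n - |S|) neighbours. *)
Lemma casimirE f S : (\sum_k a k *: T_ k f) S =
  (#|S| * (n - #|S|))%:R * f S - swap_sum f S.
Proof.
rewrite sum_gaudin_opE.
transitivity (\sum_(k in S) \sum_(j | j \notin S) (f S - f (tperm k j @: S))).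
  apply: eq_bigr => k kS; apply: eq_bigr => j jS; rewrite /gap_inv mulfV ?mul1r //.
  by rewrite subr_eq0 (inj_eq a_inj); apply: contraNneq jS => <-.
under eq_bigr => k _ do rewrite sumrB.
rewrite sumrB; congr (_ - _).
under eq_bigr => k _ do rewrite sumr_const.
rewrite sumr_const -mulrnA mulr_natl mulnC; congr (_ *+ (_ * _)).
have -> : #|[pred j | j \notin S]| = #|~: S| by apply: eq_card => j; rewrite !inE.
by rewrite cardsCs finset.setCK card_ord.
Qed.

Lemma raising_lowering f S : raising (lowering f) S = #|S|%:R * f S + swap_sum f S.
Proof.
rewrite sum_ffunE (eq_bigr (fun j => if j \in S then f S +
   \sum_(k | k \notin S) f (tperm j k @: S) else 0)); last first.
  move=> j _; rewrite ffunE; case: ifP => // jS; rewrite sum_ffunE (bigD1 j) //=.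
  rewrite ffunE !inE eqxx /= finset.setD1K //; congr (_ + _).
  rewrite (bigID (mem S)) /= big1 ?add0r => [|k /andP[kj kS]]; last first.
    by rewrite ffunE !inE kj kS.
  rewrite [RHS](eq_bigl (fun k => (k != j) && (k \notin S))); last first.
    by move=> k; case: eqP => // ->; rewrite jS.
  apply: eq_bigr => k /andP[kj kS]; rewrite ffunE !inE (negbTE kS) andbF.
  by rewrite tperm_imset_exchange.
by rewrite -big_mkcond big_split /= sumr_const mulr_natl.
Qed.

Lemma lowering_raising f S : lowering (raising f) S = (n - #|S|)%:R * f S + swap_sum f S.
Proof.
rewrite sum_ffunE (eq_bigr (fun k => if k \notin S then f S +
   \sum_(j in S) f (tperm j k @: S) else 0)); last first.
  move=> k _; rewrite ffunE; case: ifPn => // kS; rewrite sum_ffunE (bigD1 k) //=.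
  rewrite ffunE setU11 finset.setU1K //; congr (_ + _).
  rewrite (bigID (mem S)) /= [X in _ + X]big1 ?addr0 => [|j /andP[jk jS]]; last first.
    by rewrite ffunE !inE (negbTE jk) (negbTE jS).
  rewrite [RHS](eq_bigl (fun j => (j != k) && (j \in S))); last first.
    by move=> j; case: eqP => // ->; rewrite (negbTE kS).
  apply: eq_bigr => j /andP[jk jS]; rewrite ffunE !inE jS orbT tperm_imset_exchange //.
  congr (f _); apply/setP => x; rewrite !inE; case: (eqVneq x k) => [->|_] //=.
  by rewrite eq_sym jk.
rewrite -big_mkcond big_split /= sumr_const mulr_natl exchange_big; congr (_ *+ _ + _).
have -> : #|[pred j | j \notin S]| = #|~: S| by apply: eq_card => j; rewrite !inE.
by rewrite cardsCs finset.setCK card_ord.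
Qed.
End Levels.

(** * Reality, singular vectors and simplicity at the middle level *)

Section Spectrum.
Variables (C : numClosedFieldType) (n : nat) (a : 'I_n -> C).
Hypothesis a_inj : injective a.
Hypothesis a_real : forall k, a k \is Num.real.
Local Notation fun_set := {ffun {set 'I_n} -> C}.
Local Notation T_ := (gaudin_op a).
Local Notation X_ := (mult_op a).
Implicit Types (f g u v : fun_set) (S : {set 'I_n}) (i j k : 'I_n) (l m p : nat) (x : 'I_n -> C).

Definition dot f g := \sum_S f S * (g S)^*.

Lemma dotC f g : dot f g = (dot g f)^*.
Proof.
by rewrite /dot rmorph_sum; apply: eq_bigr => S _; rewrite rmorphM /= conjCK mulrC.
Qed.

Lemma dotZl c f g : dot (c *: f) g = c * dot f g.
Proof.
by rewrite /dot mulr_sumr; apply: eq_bigr => S _; rewrite ffunE /GRing.scale /= mulrA.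
Qed.

Lemma dotZr c f g : dot f (c *: g) = c^* * dot f g.
Proof. by rewrite dotC dotZl rmorphM /= -dotC. Qed.

Lemma dotBl f g h : dot (f - g) h = dot f h - dot g h.
Proof. by rewrite /dot -sumrB; apply: eq_bigr => S _; rewrite !ffunE mulrBl. Qed.

Lemma dotBr f g h : dot f (g - h) = dot f g - dot f h.
Proof. by rewrite dotC dotBl rmorphB /= -!dotC. Qed.

Lemma dot_suml I (r : seq I) P (G : I -> fun_set) h :
  dot (\sum_(i <- r | P i) G i) h = \sum_(i <- r | P i) dot (G i) h.
Proof.
rewrite /dot exchange_big; apply: eq_bigr => S _.
by rewrite sum_ffunE mulr_suml.
Qed.

Lemma dot_sumr I (r : seq I) P (G : I -> fun_set) h :
  dot h (\sum_(i <- r | P i) G i) = \sum_(i <- r | P i) dot h (G i).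
Proof. by rewrite dotC dot_suml rmorph_sum; apply: eq_bigr => i _ /=; rewrite -dotC. Qed.

Lemma dot_ge0 f : 0 <= dot f f.
Proof. by apply: sumr_ge0 => S _; apply: mul_conjC_ge0. Qed.

Lemma dot_eq0 f : (dot f f == 0) = (f == 0).
Proof.
apply/eqP/eqP => [/eqP|->]; last by rewrite /dot big1 // => S _; rewrite ffunE mul0r.
rewrite psumr_eq0 => [/allP f0|S _]; last exact: mul_conjC_ge0.
apply/ffunP => S; have := f0 S (mem_index_enum S).
by rewrite mul_conjC_eq0 ffunE => /eqP.
Qed.

Lemma dot_swap i j f g : dot (swap_op i j f) g = dot f (swap_op i j g).
Proof.
rewrite /dot (reindex_inj (h := fun S => tperm i j @: S)) /=; last first.
  by apply: (can_inj (g := fun S => tperm i j @: S)) => S; apply/setP => y;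
     rewrite !mem_tperm_imset tpermK.
apply: eq_bigr => S _; rewrite !ffunE; congr (f _ * _); apply/setP => y.
by rewrite !mem_tperm_imset tpermK.
Qed.

Lemma dot_gaudin k f g : dot (T_ k f) g = dot f (T_ k g).
Proof.
rewrite dot_suml dot_sumr; apply: eq_bigr => j _; rewrite dotZl dotZr.
rewrite /diff_op dotBl dotBr dot_swap; congr (_ * _).
by apply/esym/CrealP; rewrite rpredV rpredB.
Qed.

Lemma dot_lowering f g : dot (lowering f) g = dot f (raising g).
Proof.
rewrite dot_suml dot_sumr; apply: eq_bigr => k _; rewrite /dot.
rewrite (bigID (fun S => k \in S)) /= big1 ?add0r => [|S kS]; last first.
  by rewrite ffunE kS mul0r.
rewrite [RHS](bigID (fun S => k \in S)) /= [X in _ = _ + X]big1 ?addr0 => [|S kS]; last first.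
  by rewrite ffunE (negbTE kS) rmorph0 mulr0.
rewrite (reindex_onto (fun S => S :\ k) (fun S => k |: S)) /=; last first.
  by move=> S kS; rewrite finset.setU1K.
apply: eq_big => [S|S].
  by rewrite !inE eqxx /=; apply/eqP/idP => [<-|/finset.setD1K ->//]; rewrite setU11.
move=> /andP[_ /eqP e]; have kS : k \in S by rewrite -e setU11.
by rewrite !ffunE e kS !inE eqxx.
Qed.

Definition joint_eigen x f := forall k, T_ k f = x k *: f.

Lemma joint_eigen_real x f k : joint_eigen x f -> f != 0 -> x k \is Num.real.
Proof.
move=> fx f0; have := dot_gaudin k f f; rewrite fx dotZl dotZr.
by move/mulIf; rewrite dot_eq0 => /(_ f0)/esym/CrealP.
Qed.

Lemma scalef_inj f : f != 0 -> injective (fun c : C => c *: f).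
Proof.
move=> f0 c d /eqP; rewrite -subr_eq0 -scalerBl scaler_eq0 (negbTE f0) orbF subr_eq0.
by move=> /eqP.
Qed.

Lemma joint_eigen_solution x f : joint_eigen x f -> f != 0 -> gaudin_solution a x.
Proof.
move=> fx f0 k; apply: (scalef_inj f0) => /=; have := gaudin_op_sqr a_inj k f.
rewrite fx linearZ /= fx scalerA -expr2 => ->; rewrite scaler_suml; apply: eq_bigr => j _.
by rewrite fx -scalerBl scalerA.
Qed.

Lemma dot_raising f g : dot (raising f) g = dot f (lowering g).
Proof. by rewrite dotC -dot_lowering -dotC. Qed.

(** The adjoint of [lowering_gaudin]: the commutator applied to f pairs to zero with every function,
    in particular with itself. *)
Lemma raising_gaudin k f : raising (T_ k f) = T_ k (raising f).
Proof.
apply/eqP; rewrite -subr_eq0 -dot_eq0 dotBl dot_raising !dot_gaudin -lowering_gaudin //.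
by rewrite dot_raising subrr.
Qed.

(** The eigenvalue of the Casimir combination on vectors of level m that are annihilated by
    lowering. *)
Definition weight m : C := m%:R * (n.+1%:R - m%:R).

(** The weight is a quadratic polynomial symmetric about (n + 1) / 2, and l + m < 2 m keeps l and m
    from being mirror images. *)
Lemma weight_inj l m : (l < m)%N -> (m.*2 <= n.+1)%N -> weight l != weight m.
Proof.
move=> lm mn; rewrite -subr_eq0.
have -> : weight l - weight m = (m%:R - l%:R) * ((m + l)%:R - n.+1%:R).
  by rewrite /weight natrD; ring.
rewrite mulf_neq0 // subr_eq0 eqr_nat; first by rewrite gtn_eqF.
by rewrite ltn_eqF // (leq_trans _ mn) // -addnn ltn_add2l.
Qed.

Definition casimir f := \sum_k a k *: T_ k f.

Lemma card_le_n S : (#|S| <= n)%N.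
Proof. by rewrite -[X in (_ <= X)%N](card_ord n) max_card. Qed.

Lemma raising_loweringE m f : level_part m f = f ->
  raising (lowering f) = weight m *: f - casimir f.
Proof.
move=> fm; apply/ffunP => S; rewrite raising_lowering !ffunE /casimir casimirE // /GRing.scale /=.
have [Sm|Sm] := eqVneq #|S| m.
  rewrite natrM (natrB _ (card_le_n S)) Sm /weight -natr1; ring.
have -> : f S = 0 by rewrite -fm ffunE (negbTE Sm).
ring.
Qed.

Lemma lowering_raisingE m f : level_part m f = f ->
  lowering (raising f) = weight m.+1 *: f - casimir f.
Proof.
move=> fm; apply/ffunP => S; rewrite lowering_raising !ffunE /casimir casimirE // /GRing.scale /=.
have [Sm|Sm] := eqVneq #|S| m.
  by rewrite natrM (natrB _ (card_le_n S)) Sm /weight -(natr1 n) -(natr1 m); ring.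
have -> : f S = 0 by rewrite -fm ffunE (negbTE Sm).
ring.
Qed.

Lemma casimir_joint_eigen x f : joint_eigen x f -> casimir f = (\sum_k a k * x k) *: f.
Proof.
move=> fx; rewrite /casimir scaler_suml; apply: eq_bigr => k _.
by rewrite fx scalerA.
Qed.

(** The squared norm of [raising f] is (n - 2 m) times that of f, and positivity bounds the
    level. *)
Lemma singular_joint_eigen m x f : joint_eigen x f -> level_part m f = f -> f != 0 ->
  lowering f = 0 -> \sum_k a k * x k = weight m /\ (m.*2 <= n)%N.
Proof.
move=> fx fm f0 Df.
have e : \sum_k a k * x k = weight m.
  apply: (scalef_inj f0) => /=; rewrite -(casimir_joint_eigen fx); apply/eqP.
  by rewrite eq_sym -subr_eq0 -raising_loweringE // Df linear0.
split=> //; have := dot_ge0 (raising f).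
rewrite dot_raising (lowering_raisingE fm) (casimir_joint_eigen fx) e -scalerBl dotZr.
have [S /eqP Sm] : exists S, #|S| == m.
  apply/existsP; apply: contraNT f0 => /existsPn Sm; apply/eqP/ffunP => S.
  by rewrite -fm !ffunE (negbTE (Sm S)).
have mn : (m <= n)%N by rewrite -Sm card_le_n.
have -> : weight m.+1 - weight m = n%:R - (m.*2)%:R.
  by rewrite /weight -addnn natrD -!natr1; ring.
have f_gt0 : 0 < dot f f by rewrite lt_def dot_eq0 f0 dot_ge0.
by rewrite rmorphB !rmorph_nat pmulr_lge0 // subr_ge0 ler_nat.
Qed.

Lemma linearBZ (L : {linear fun_set -> fun_set}) c u v : L (u - c *: v) = L u - c *: L v.
Proof. by rewrite linearB linearZ. Qed.

Definition mult_eigen x f := forall k, X_ k f = x k *: f.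

Lemma top_level f : f != 0 -> exists m, below m.+1 f /\ level_part m f != 0.
Proof.
move=> f0; have [S0 fS0] : exists S, f S != 0.
  apply/existsP; apply: contraNT f0 => /existsPn fS; apply/eqP/ffunP => S.
  by rewrite ffunE; apply/eqP; have := fS S; rewrite negbK.
case: (@arg_maxnP _ S0 (fun S => f S != 0) (fun S => #|S|) fS0) => S fS maxS; exists #|S|; split.
  by move=> T ST; apply/eqP; apply: contraLR ST => /maxS; rewrite -leqNgt.
by apply: contraNneq fS => /ffunP/(_ S); rewrite !ffunE eqxx => ->.
Qed.

(** At the top level of an eigenfunction N_k has nothing above to bring down, so there X_k acts as
    T_k. *)
Lemma solution_singular x : gaudin_solution a x -> exists m f,
  [/\ joint_eigen x f, f != 0, level_part m f = f & lowering f = 0].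
Proof.
move=> xsol; have [f f1 fx] := eigenfunction_exists a_inj xsol.
have f0 : f != 0.
  by apply/eqP => e; move: f1; rewrite e ffunE => /eqP; rewrite eq_sym oner_eq0.
have [m [fm fm0]] := top_level f0; exists m, (level_part m f).
have Df : lowering f = (\sum_k x k) *: f.
  by rewrite (loweringE a) // scaler_suml; apply: eq_bigr => k _.
(* Lowering multiplies f by the sum of the x_k, yet leaves nothing at the top level m, where f is
   nonzero. So this sum is 0. *)
have Df0 : lowering f = 0.
  have : level_part m (lowering f) = 0.
    rewrite level_part_lowering [level_part _ _](_ : _ = 0) ?linear0 //.
    by apply/ffunP => S; rewrite !ffunE; case: eqP => // Sm; rewrite fm // Sm.
  rewrite Df linearZ /= => /eqP; rewrite scaler_eq0 (negbTE fm0) orbF => /eqP ->.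
  by rewrite scale0r.
split=> //; last 2 first.
- exact: level_part_id.
- case: m {fm fm0} => [|m]; first exact: lowering_level0.
  by rewrite -level_part_lowering Df0 linear0.
by move=> k; rewrite -level_part_mult // fx linearZ.
Qed.

(** A combination of the X_k that separates levels: on functions annihilated by lowering it is
    triangular with respect to level, with diagonal entries [weight m]. *)
Definition euler_op f : fun_set := \sum_k a k *: X_ k f.
Fact euler_op_linear : linear euler_op.
Proof.
move=> c f g; rewrite /euler_op scaler_sumr -big_split; apply: eq_bigr => k _ /=.
by rewrite linearP scalerDr !scalerA mulrC.
Qed.
HB.instance Definition _ := GRing.isLinear.Build C fun_set fun_set _ euler_op euler_op_linear.

Lemma euler_mult k f : euler_op (X_ k f) = X_ k (euler_op f).
Proof.
rewrite /euler_op linear_sum; apply: eq_bigr => j _.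
by rewrite linearZ /= mult_op_comm.
Qed.

Lemma lowering_euler f : lowering (euler_op f) = euler_op (lowering f).
Proof.
rewrite /euler_op linear_sum; apply: eq_bigr => j _.
by rewrite linearZ /= lowering_mult.
Qed.

Lemma euler_below m f : below m f -> below m (euler_op f).
Proof.
move=> fm S Sm; rewrite sum_ffunE big1 // => k _.
by rewrite ffunE (mult_below a k fm) // scaler0.
Qed.

Lemma level_part_euler m f : below m.+1 f -> lowering f = 0 ->
  level_part m (euler_op f) = weight m *: level_part m f.
Proof.
move=> fm Df; have Dfm : lowering (level_part m f) = 0.
  case: m {fm} => [|m]; first exact: lowering_level0.
  by rewrite -level_part_lowering Df linear0.
have -> : level_part m (euler_op f) = casimir (level_part m f).
  rewrite linear_sum; apply: eq_bigr => k _.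
  by rewrite linearZ /= level_part_mult.
apply/eqP; rewrite eq_sym -subr_eq0 -(raising_loweringE (level_part_id m f)) Dfm.
by rewrite linear0.
Qed.

(** Below level l only the weights of smaller levels are available as eigenvalues, and none of them
    equals [weight m]. *)
Lemma euler_weight_eq0 l m f : (l <= m)%N -> (m.*2 <= n.+1)%N -> below l f ->
  lowering f = 0 -> euler_op f = weight m *: f -> f = 0.
Proof.
move=> lm mn + Df fE; elim: l lm => [_|l IH lm fl]; first exact: below0.
apply: IH; first exact: ltnW.
apply: below_level_part => //.
have := level_part_euler fl Df; rewrite fE linearZ /= => /eqP.
rewrite -subr_eq0 -scalerBl scaler_eq0 subr_eq0 eq_sym (negbTE (weight_inj lm mn)).
by move/eqP.
Qed.

(* [descent p] is the product of the operators [Q - weight l], l < p, for the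
   commuting operator Q = [euler_op]; the factor with index p - 1 is applied first. *)
Fixpoint descent p f :=
  if p is q.+1 then descent q (euler_op f - weight q *: f) else f.

Lemma descent_linear p : linear (descent p).
Proof.
elim: p => //= p IH c f g; rewrite -IH; congr (descent p _).
by rewrite linearP; apply/ffunP => S; rewrite !ffunE /GRing.scale /=; ring.
Qed.
HB.instance Definition _ p :=
  GRing.isLinear.Build C fun_set fun_set _ (descent p) (descent_linear p).

Lemma descent_euler p f : descent p (euler_op f) = euler_op (descent p f).
Proof.
elim: p f => //= p IH f; rewrite -IH; congr (descent p _).
by rewrite [RHS]linearBZ.
Qed.

Lemma euler_step f p m : below m f -> lowering f = 0 ->
  below m (euler_op f - weight p *: f) /\ lowering (euler_op f - weight p *: f) = 0.
Proof.
move=> fm Df; split; last by rewrite linearBZ /= lowering_euler Df [euler_op 0]linear0 scaler0 subrr.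
by move=> S Sm; rewrite !ffunE (euler_below fm) // fm // scaler0 subrr.
Qed.

Lemma descent_eq0 p f : below p f -> lowering f = 0 -> descent p f = 0.
Proof.
elim: p f => [|p IH] f fp Df /=; first exact: below0.
have [fp' Df'] := euler_step p fp Df; apply: IH => //.
apply: below_level_part => //.
by rewrite linearBZ /= level_part_euler // subrr.
Qed.

Lemma lowering_descent p f : lowering f = 0 -> lowering (descent p f) = 0.
Proof.
elim: p f => //= p IH f Df; apply: IH.
by rewrite linearBZ /= lowering_euler Df [euler_op 0]linear0 scaler0 subrr.
Qed.

Lemma level_part_descent p m f : below m.+1 f -> lowering f = 0 ->
  below m.+1 (descent p f) /\
  level_part m (descent p f) = (\prod_(l < p) (weight m - weight l)) *: level_part m f.
Proof.
elim: p f => [|p IH] f fm Df /=; first by rewrite big_ord0 scale1r.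
have [fm' Df'] := euler_step p fm Df; have [? ->] := IH _ fm' Df'; split=> //.
rewrite linearBZ /= level_part_euler // -scalerBl scalerA big_ord_recr /=.
by [].
Qed.

(** The converse of [solution_singular]. An eigenvector of the T_k is corrected at lower levels: the
    product of Q - weight l over l < m removes the lower weights and multiplies the top level by a
    product of differences of weights. *)
Lemma singular_lift m x f : joint_eigen x f -> level_part m f = f -> f != 0 ->
  lowering f = 0 -> exists c g, [/\ c != 0, mult_eigen x g & level_part m g = c *: f].
Proof.
move=> fx fm f0 Df; have fbelow := level_part_below fm.
have [xm mn] := singular_joint_eigen fx fm f0 Df.
have mn' : (m.*2 <= n.+1)%N by apply: ltnW.
exists (\prod_(l < m) (weight m - weight l)), (descent m f).
have [gbelow gm] := level_part_descent m fbelow Df.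
have Dg := lowering_descent m Df.
have gE : euler_op (descent m f) = weight m *: descent m f.
  apply/eqP; rewrite -subr_eq0 -descent_euler -linearZ -linearB /=; apply/eqP.
  have [hm Dh] := euler_step m fbelow Df.
  apply: descent_eq0 => //; apply: below_level_part => //.
  by rewrite linearBZ /= level_part_euler // subrr.
split; last by rewrite gm fm.
- by apply/prodf_neq0 => l _; rewrite subr_eq0 eq_sym weight_inj.
move=> k; apply/eqP; rewrite -subr_eq0; apply/eqP.
(* The defect X_k g - x_k g has lost its top level but still belongs to the eigenvalue [weight m] of
   Q, so it vanishes. *)
apply: (@euler_weight_eq0 m m) => //.
- apply: below_level_part.
    by move=> S Sm; rewrite ffunE (mult_below a k gbelow) // !ffunE gbelow // scaler0 subrr.
  rewrite linearBZ /= level_part_mult // gm fm linearZ /= fx.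
  by rewrite !scalerA mulrC subrr.
- by rewrite linearBZ /= lowering_mult // Dg [X_ k 0]linear0 scaler0 subrr.
by rewrite linearBZ /= euler_mult gE scalerBr linearZ /= !scalerA mulrC.
Qed.

(** Both vectors lift to joint eigenfunctions of the X_k, and these are determined by their value at
    the empty set. Hence the lifts, and with them the top levels, are proportional. *)
Lemma singular_unique m x f f' : joint_eigen x f -> level_part m f = f -> f != 0 ->
  lowering f = 0 -> joint_eigen x f' -> level_part m f' = f' -> lowering f' = 0 ->
  exists c, f' = c *: f.
Proof.
move=> fx fm f0 Df fx' fm' Df'.
have [->|f0'] := eqVneq f' 0; first by exists 0; rewrite scale0r.
have [c [g [c0 gx gm]]] := singular_lift fx fm f0 Df.
have [c' [g' [c0' gx' gm']]] := singular_lift fx' fm' f0' Df'.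
have g_neq0 : g finset.set0 != 0.
  apply: contra_neq f0 => /(eigenfunction_eq0 gx) g0.
  by move: gm; rewrite g0 linear0 => /esym/eqP; rewrite scaler_eq0 (negbTE c0) => /eqP.
have : g finset.set0 *: g' - g' finset.set0 *: g = 0.
  apply: (eigenfunction_eq0 (a := a) (x := x)) => [k|].
    by rewrite linearBZ linearZ /= gx gx' scalerBr !scalerA !(mulrC (x k)).
  by rewrite !ffunE /GRing.scale /= mulrC subrr.
move=> /(congr1 (level_part m)); rewrite linearBZ linear0 linearZ /= gm gm' => /eqP.
rewrite subr_eq0 !scalerA => /eqP e.
exists ((g finset.set0 * c')^-1 * (g' finset.set0 * c)).
by rewrite -scalerA -e scalerA mulVf ?scale1r // mulf_neq0.
Qed.

(** The singular vector is raised level by level. Raising does not kill it up to the middle, because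
    lowering afterwards multiplies by a nonzero difference of weights. *)
Lemma middle_level_exists x : gaudin_solution a x ->
  exists f, [/\ joint_eigen x f, f != 0 & level_part n./2 f = f].
Proof.
move=> /solution_singular [m [f [fx f0 fm Df]]].
have [xm mn] := singular_joint_eigen fx fm f0 Df.
have mh : (m <= n./2)%N by lia.
suff: forall p, (m + p <= n./2)%N -> exists g,
    [/\ joint_eigen x g, g != 0 & level_part (m + p) g = g].
  by move=> /(_ (n./2 - m)%N); rewrite subnKC // => /(_ (leqnn _)).
elim=> [_|p IH pm]; first by exists f; rewrite addn0.
have [|g [gx g0 gm]] := IH; first by rewrite (leq_trans _ pm) // addnS.
exists (raising g); split.
- by move=> k; rewrite -raising_gaudin gx linearZ.
- apply: contraNneq g0 => Ug; have := lowering_raisingE gm.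
  rewrite Ug linear0 (casimir_joint_eigen gx) xm -scalerBl => /esym/eqP.
  rewrite scaler_eq0 subr_eq0 eq_sym (negbTE (weight_inj _ _)) //; first by rewrite ltnS leq_addr.
  by rewrite -addnS; lia.
- by rewrite addnS level_part_raising gm.
Qed.

(** The level m of the singular vector can be read off from x through the Casimir eigenvalue.
    Uniqueness then climbs from level m, since lowering is injective on the eigenvectors in
    between. *)
Lemma middle_level_unique x f f' : joint_eigen x f -> level_part n./2 f = f -> f != 0 ->
  joint_eigen x f' -> level_part n./2 f' = f' -> exists c, f' = c *: f.
Proof.
move=> fx fm f0 fx' fm'.
have [m [s [sx s0 sm Ds]]] := solution_singular (joint_eigen_solution fx f0).
have [xm mn] := singular_joint_eigen sx sm s0 Ds.
suff: forall p, (m + p <= n./2)%N -> forall u u', joint_eigen x u -> level_part (m + p) u = u ->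
    u != 0 -> joint_eigen x u' -> level_part (m + p) u' = u' -> exists c, u' = c *: u.
  move=> /(_ (n./2 - m)%N); rewrite subnKC; last by lia.
  by move=> /(_ (leqnn _) f f'); apply.
elim=> [_|p IH pm] u u' ux um u0 ux' um'.
  (* At level m any eigenvector for x is singular: the squared norm of its lowering is [weight m]
     minus the Casimir eigenvalue, times its own squared norm, hence 0. *)
  have sing v : joint_eigen x v -> level_part m v = v -> lowering v = 0.
    move=> vx vm; apply/eqP; rewrite -dot_eq0 dot_lowering (raising_loweringE vm).
    by rewrite (casimir_joint_eigen vx) xm subrr /dot big1 // => S _; rewrite ffunE conjC0 mulr0.
  rewrite addn0 in um um'.
  exact: (singular_unique ux um u0 (sing _ ux um) ux' um' (sing _ ux' um')).
have w0 : weight (m + p.+1) - weight m != 0.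
  by rewrite subr_eq0 eq_sym weight_inj //; lia.
have UD v : joint_eigen x v -> level_part (m + p.+1) v = v ->
    raising (lowering v) = (weight (m + p.+1) - weight m) *: v.
  by move=> vx vm; rewrite (raising_loweringE vm) (casimir_joint_eigen vx) xm -scalerBl.
have Dx v : joint_eigen x v -> joint_eigen x (lowering v).
  by move=> vx k; rewrite -lowering_gaudin // vx linearZ.
have Dm v : level_part (m + p.+1) v = v -> level_part (m + p) (lowering v) = lowering v.
  by move=> vm; rewrite level_part_lowering -addnS vm.
have [||||||c e] := IH _ (lowering u) (lowering u'); rewrite ?Dm //; try exact: Dx.
- by rewrite (leq_trans _ pm) // addnS.
- apply: contraNneq u0 => Du; have := UD u ux um; rewrite Du linear0 => /esym/eqP.
  by rewrite scaler_eq0 (negbTE w0).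
exists c; have := UD u' ux' um'; rewrite e linearZ /= UD // scalerA mulrC -scalerA => /eqP.
by rewrite -subr_eq0 -scalerBr scaler_eq0 (negbTE w0) subr_eq0 eq_sym => /eqP.
Qed.
End Spectrum.

(** * Matrices of the Gaudin Hamiltonians at the middle level *)

Definition middle_level n : {set {set 'I_n}} := [set S : {set 'I_n} | #|S| == n./2].

Section MiddleMatrix.
Variables (F : numFieldType) (n : nat) (a : 'I_n -> F).
Hypothesis a_inj : injective a.
Local Notation fun_set := {ffun {set 'I_n} -> F}.
Local Notation N := #|middle_level n|.

(** Explicit entries let the matrix be transported from R to the complex numbers and later be
    multiplied by a common denominator. *)
Definition gaudin_mx k : 'M[F]_N := \matrix_(i < N, j < N) \sum_l gap_inv a k l *
  ((enum_val i == enum_val j)%:R - (tperm k l @: (enum_val i : {set 'I_n}) == enum_val j)%:R).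

Definition to_middle (f : fun_set) : 'cV[F]_N := \col_i f (enum_val i).
Definition of_middle (v : 'cV[F]_N) : fun_set :=
  [ffun S => \sum_i (S == enum_val i)%:R * v i 0].

Lemma sum_middle (f : fun_set) S : S \in middle_level n ->
  \sum_(j < N) (S == enum_val j)%:R * f (enum_val j) = f S.
Proof.
move=> SN; rewrite -(big_enum_val (fun T : {set 'I_n} => (S == T)%:R * f T)).
rewrite (bigD1 S) //= eqxx mul1r big1 ?addr0 // => T /andP[_ /negbTE TS].
by rewrite eq_sym TS mul0r.
Qed.

Lemma of_middleK : cancel of_middle to_middle.
Proof.
move=> v; apply/colP => i; rewrite !mxE ffunE (bigD1 i) //= eqxx mul1r big1 ?addr0 // => j ji.
by rewrite (inj_eq enum_val_inj) eq_sym (negbTE ji) mul0r.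
Qed.

Lemma to_middle_inj f g : level_part n./2 f = f -> level_part n./2 g = g ->
  to_middle f = to_middle g -> f = g.
Proof.
move=> fm gm /colP e; apply/ffunP => S; rewrite -fm -gm !ffunE; case: eqP => // /eqP Sm.
have SN : S \in middle_level n by rewrite inE.
by have := e (enum_rank_in SN S); rewrite !mxE enum_rankK_in.
Qed.

Lemma level_part_of_middle v : level_part n./2 (of_middle v) = of_middle v.
Proof.
apply/ffunP => S; rewrite !ffunE; case: ifPn => // Sm; rewrite big1 // => i _.
case: eqP => [Si|]; rewrite ?mul0r //.
by move: Sm (enum_valP i); rewrite Si inE => /negbTE ->.
Qed.

Lemma gaudin_mx_mul k f : gaudin_mx k *m to_middle f = to_middle (gaudin_op a k f).
Proof.
apply/colP => i; rewrite !mxE sum_ffunE.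
under eq_bigr => j _ do rewrite !mxE mulr_suml.
rewrite exchange_big; apply: eq_bigr => l _ /=; rewrite !ffunE /GRing.scale /=.
under eq_bigr => j _ do rewrite -mulrA mulrBl.
rewrite -mulr_sumr sumrB !sum_middle //; last exact: enum_valP.
by rewrite inE card_tperm_imset; have := enum_valP i; rewrite inE.
Qed.

Lemma eq_mulmxcV (A B : 'M[F]_N) : (forall v : 'cV_N, A *m v = B *m v) -> A = B.
Proof.
by move=> e; apply/matrixP => i j; have /colP/(_ i) := e (delta_mx j 0); rewrite -!colE !mxE.
Qed.

Lemma gaudin_mx_comm k l : gaudin_mx k *m gaudin_mx l = gaudin_mx l *m gaudin_mx k.
Proof.
apply: eq_mulmxcV => v; rewrite -(of_middleK v) -!mulmxA !gaudin_mx_mul.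
by rewrite gaudin_op_comm.
Qed.

Lemma gaudin_mx_sym k : (gaudin_mx k)^T = gaudin_mx k.
Proof.
apply/matrixP => i j; rewrite !mxE; apply: eq_bigr => l _; congr (_ * (_%:R - _%:R)).
  by rewrite eq_sym.
have tK (S T : {set 'I_n}) : tperm k l @: S = T -> tperm k l @: T = S.
  by move=> <-; apply/setP => x; rewrite !mem_tperm_imset tpermK.
by congr nat_of_bool; apply/idP/idP => /eqP/tK/eqP.
Qed.

Lemma of_middle_eigen k c (v : 'cV[F]_N) : gaudin_mx k *m v = c *: v ->
  gaudin_op a k (of_middle v) = c *: of_middle v.
Proof.
move=> e; apply: to_middle_inj.
- by rewrite level_part_gaudin level_part_of_middle.
- by rewrite linearZ /= level_part_of_middle.
rewrite -gaudin_mx_mul of_middleK e; apply/colP => i.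
by rewrite !mxE ffunE -[in LHS](of_middleK v) !mxE.
Qed.
End MiddleMatrix.

(** * Simultaneous diagonalization and the list of all real solutions *)

Section Codiagonal.
Variables (C : numClosedFieldType) (N p : nat) (A : 'I_p -> 'M[C]_N).
Hypothesis A_comm : forall k l, A k *m A l = A l *m A k.
Hypothesis A_sym : forall k, (A k)^T = A k.
Hypothesis A_real : forall k i j, A k i j \is Num.real.

Lemma real_symmetric_codiagonalizable : exists (P : 'M[C]_N) (d : 'I_p -> 'rV[C]_N),
  P \in unitmx /\ forall k, P *m A k = diag_mx (d k) *m P.
Proof.
have [+ _] := codiagonalizableP [seq A k | k <- enum 'I_p].
case.
  split=> [B D /mapP[k _ ->] /mapP[l _ ->]|B /mapP[k _ ->]]; first exact: A_comm.
  have /orthomx_spectralP e : A k \is normalmx.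
    apply: symmetric_normalmx; last by apply/mxOverP.
    by apply/is_hermitianmxP; rewrite expr0 scale1r map_mx_id ?A_sym.
  exists (spectralmx (A k)); first exact: spectral_unit.
  apply/similar_diagPex; exists (spectral_diag (A k)).
  apply/similarP; first exact: spectral_unit.
  by rewrite {2}e !mulmxA mulmxV ?spectral_unit // mul1mx.
move=> P Punit /allP/= AP; exists P.
have /fin_all_exists [d dE] k : exists d, P *m A k = diag_mx d *m P.
  have /AP /similar_diagPex [d /similarP] : A k \in [seq A k | k <- enum 'I_p].
    by apply: map_f; rewrite mem_enum.
  by move=> /(_ Punit); exists d.
by exists d.
Qed.
End Codiagonal.

Lemma char_poly_similar_diag (F : fieldType) N (P L : 'M[F]_N) (D : 'rV[F]_N) :
  P \in unitmx -> P *m L = diag_mx D *m P -> char_poly L = \prod_i ('X - (D 0 i)%:P).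
Proof.
move=> Pu e; have charD : char_poly (diag_mx D) = \prod_i ('X - (D 0 i)%:P).
  rewrite (char_poly_trig (diag_mx_is_trig D)); apply: eq_bigr => i _.
  by rewrite mxE eqxx mulr1n.
rewrite -charD /char_poly.
have e' : map_mx polyC P *m char_poly_mx L = char_poly_mx (diag_mx D) *m map_mx polyC P.
  by rewrite /char_poly_mx mulmxBr mulmxBl -!map_mxM e scalar_mxC.
have := congr1 (fun M => \det M) e'; rewrite !det_mulmx [LHS]mulrC => /mulIf; apply.
by rewrite det_map_mx polyC_eq0 -unitfE -unitmxE.
Qed.

Section GaudinSpectrum.
Variables (R : realType) (n : nat) (a : 'I_n -> R).
Hypothesis a_inj : injective a.
Local Notation N := #|middle_level n|.
Local Notation aC := (real_complex R \o a).

Let aC_inj : injective aC.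
Proof. by move=> i j /complexI/a_inj. Qed.

Let aC_real k : aC k \is Num.real.
Proof. by rewrite complex_real. Qed.

Lemma gap_inv_complex i j : gap_inv aC i j = real_complex R (gap_inv a i j).
Proof. by rewrite /gap_inv /= -rmorphB fmorphV. Qed.

Lemma gaudin_solution_complex (x : 'I_n -> R) :
  gaudin_solution aC (real_complex R \o x) <-> gaudin_solution a x.
Proof.
have e k : \sum_j gap_inv aC k j * ((real_complex R \o x) k - (real_complex R \o x) j) =
    real_complex R (\sum_j gap_inv a k j * (x k - x j)).
  by rewrite rmorph_sum; apply: eq_bigr => j _; rewrite rmorphM rmorphB gap_inv_complex.
split=> xsol k; last by rewrite e -xsol /= rmorphXn.
by apply: (@complexI R); rewrite -e -xsol rmorphXn.
Qed.

Lemma gaudin_mx_complex k : gaudin_mx aC k = map_mx (real_complex R) (gaudin_mx a k).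
Proof.
apply/matrixP => i j; rewrite !mxE rmorph_sum; apply: eq_bigr => l _.
by rewrite rmorphM rmorphB !rmorph_nat gap_inv_complex.
Qed.

(** The diagonalization is over the complex numbers, but the joint eigenvalues are real. Each row of
    P, transposed by symmetry of the matrices, is a joint eigenvector and contributes one
    solution. *)
Lemma gaudin_spectrum : exists X : 'I_N -> 'I_n -> R,
  [/\ forall i, gaudin_solution a (X i),
      forall x, gaudin_solution a x -> exists i, x = X i,
      injective X &
      forall xi : 'I_n -> R, char_poly (\sum_k xi k *: gaudin_mx a k) =
        \prod_i ('X - (\sum_k xi k * X i k)%:P)].
Proof.
have Greal k i j : gaudin_mx aC k i j \is Num.real.
  by rewrite gaudin_mx_complex mxE complex_real.
have [P [d [Pu Pd]]] := real_symmetric_codiagonalizable (gaudin_mx_comm aC_inj)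
  (gaudin_mx_sym aC) Greal.
pose x i k := d k 0 i.
pose f i := of_middle (row i P)^T.
have rowP0 i : row i P != 0.
  apply/eqP => /(congr1 (mulmx^~ (invmx P))); rewrite -row_mul mulmxV // mul0mx.
  by move=> /rowP/(_ i); rewrite !mxE eqxx => /eqP; rewrite oner_eq0.
have f0 i : f i != 0.
  apply: contraNneq (rowP0 i) => fi0; rewrite -trmx_eq0 -[_^T]of_middleK -/(f i) fi0.
  by apply/eqP/colP => j; rewrite !mxE ffunE.
have fx i : joint_eigen aC (x i) (f i).
  move=> k; apply: of_middle_eigen; rewrite -[gaudin_mx _ _]gaudin_mx_sym -trmx_mul.
  by rewrite -row_mul Pd row_mul row_diag_mx -scalemxAl -rowE linearZ.
have x_real i k : x i k = real_complex R (complex.Re (x i k)).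
  by rewrite RRe_real // (joint_eigen_real aC_real k (fx i) (f0 i)).
exists (fun i k => complex.Re (x i k)).
have xC i : real_complex R \o (fun k => complex.Re (x i k)) = x i.
  by apply/funext => k /=; rewrite -x_real.
split.
- move=> i; apply/gaudin_solution_complex; rewrite xC.
  exact: (joint_eigen_solution aC_inj (fx i) (f0 i)).
- move=> y /gaudin_solution_complex /(middle_level_exists aC_inj aC_real) [g [gy g0 gm]].
  (* The eigenvector of y is expanded in the rows of P. Any row with a nonzero coefficient must
     carry the same joint eigenvalues. *)
  pose v := to_middle g; have [w wP] : exists w, w *m P = v^T.
    by exists (v^T *m invmx P); rewrite mulmxKV.
  have wE k i : w 0 i * d k 0 i = (y k)%:C%C * w 0 i.
    have : w *m diag_mx (d k) = (y k)%:C%C *: w.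
      apply: (can_inj (mulmxK Pu)); rewrite -mulmxA -Pd mulmxA wP -scalemxAl wP.
      rewrite -[v^T *m _]trmxK trmx_mul trmxK gaudin_mx_sym gaudin_mx_mul gy.
      by apply/rowP => j; rewrite !mxE ffunE.
    by move=> /rowP/(_ i); rewrite mul_mx_diag !mxE.
  have [i wi] : exists i, w 0 i != 0.
    apply/existsP; apply: contraNT g0 => /existsPn w0; apply/eqP.
    apply: (to_middle_inj gm); first by rewrite linear0.
    have : w = 0 by apply/rowP => i; rewrite mxE; apply/eqP; have := w0 i; rewrite negbK.
    move=> w00; move: wP; rewrite w00 mul0mx => /esym/(congr1 trmx).
    by rewrite trmxK trmx0 /v => ->; apply/colP => j; rewrite !mxE ffunE.
  exists i; apply/funext => k; have := wE k i; rewrite mulrC => /(mulIf wi).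
  by rewrite -/(x i k) => ->.
(* By simplicity, equal eigenvalues would make two rows of the invertible matrix P proportional. *)
- move=> i j e; have xij : x i = x j by rewrite -(xC i) -(xC j) e.
  have fjx : joint_eigen aC (x i) (f j) by rewrite xij; exact: fx.
  have [c fij] := middle_level_unique aC_inj (fx i) (level_part_of_middle _) (f0 i)
    fjx (level_part_of_middle _).
  have : row j P = c *: row i P.
    apply: trmx_inj; rewrite linearZ /= -[LHS]of_middleK -/(f j) fij.
    by rewrite -[in RHS](of_middleK (row i P)^T); apply/colP => k; rewrite !mxE ffunE.
  rewrite !rowE scalemxAl => /(can_inj (mulmxK Pu)) /rowP/(_ j).
  rewrite !mxE !eqxx /=; case: eqVneq => [->//|_] /=.
  by rewrite ?mulr0n mulr0 => /eqP; rewrite oner_eq0.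
move=> xi; apply: (map_poly_inj (real_complex R)); rewrite map_char_poly rmorph_prod.
have D : P *m map_mx (real_complex R) (\sum_k xi k *: gaudin_mx a k) =
    diag_mx (\sum_k (xi k)%:C%C *: d k) *m P.
  rewrite rmorph_sum mulmx_sumr raddf_sum mulmx_suml; apply: eq_bigr => k _.
  by rewrite /= map_mxZ -gaudin_mx_complex -scalemxAr Pd linearZ /= scalemxAl.
rewrite (char_poly_similar_diag Pu D); apply: eq_bigr => i _.
rewrite rmorphB /= map_polyX map_polyC; congr ('X - _%:P).
rewrite summxE raddf_sum; apply: eq_bigr => k _ /=.
by rewrite mxE rmorphM; congr (_ * _); rewrite -/(x i k) {1}x_real.
Qed.

End GaudinSpectrum.

(** * Weighted l1 norm of polynomials in several variables *)

Section WeightedNorm.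
Variables (R : realFieldType) (n : nat) (r : R).
Hypothesis r_ge0 : 0 <= r.
Local Notation poly_n := (mpoly n R).
Implicit Types (p q : poly_n) (m : multinom n) (s : seq (multinom n)).

Lemma sum_msupp_superset (V : nmodType) (G : multinom n -> V) p s :
  uniq s -> {subset msupp p <= s} -> (forall m, m \notin msupp p -> G m = 0) ->
  \sum_(m <- msupp p) G m = \sum_(m <- s) G m.
Proof.
move=> us sub G0; rewrite [RHS](bigID (mem (msupp p))) /= [X in _ + X]big1 ?addr0 //.
rewrite -[RHS]big_filter; apply: perm_big; apply: uniq_perm; rewrite ?filter_uniq ?msupp_uniq //.
by move=> m; rewrite mem_filter; case: (boolP (m \in msupp p)) => //= /sub ->.
Qed.

(** A submultiplicative norm that controls both the values on the polydisc of radius r and the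
    individual coefficients. *)
Definition mnorm (p : poly_n) : R := \sum_(m <- msupp p) `|mcoeff m p| * r ^+ mdeg m.

Let term_ge0 p m : 0 <= `|mcoeff m p| * r ^+ mdeg m.
Proof. by rewrite mulr_ge0 ?exprn_ge0. Qed.

Lemma mnorm_ge0 p : 0 <= mnorm p.
Proof. exact: sumr_ge0. Qed.

Lemma sum_mcoeff_le_mnorm p s : uniq s ->
  \sum_(m <- s) `|mcoeff m p| * r ^+ mdeg m <= mnorm p.
Proof.
move=> us; rewrite (bigID (mem (msupp p))) /= [X in _ + X]big1 ?addr0; last first.
  by move=> m mp; rewrite memN_msupp_eq0 // normr0 mul0r.
rewrite -big_filter -[X in X <= _]addr0 /mnorm.
have e : perm_eq (msupp p)
    ([seq m <- s | m \in msupp p] ++ [seq m <- msupp p | m \notin s]).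
  apply: uniq_perm; rewrite ?msupp_uniq //.
    rewrite cat_uniq !filter_uniq ?msupp_uniq // andbT /=.
    by apply/hasPn => m; rewrite !mem_filter => /andP[/negbTE -> _]; rewrite andbF.
  by move=> m; rewrite mem_cat !mem_filter; case: (m \in s); rewrite /= ?andbT ?andbF ?orbF.
by rewrite (perm_big _ e) big_cat lerD // sumr_ge0.
Qed.

Lemma mnormE p s : uniq s -> {subset msupp p <= s} ->
  mnorm p = \sum_(m <- s) `|mcoeff m p| * r ^+ mdeg m.
Proof.
move=> us sub; apply: sum_msupp_superset => // m mp.
by rewrite memN_msupp_eq0 // normr0 mul0r.
Qed.

Lemma mnorm0 : mnorm 0 = 0.
Proof. by rewrite /mnorm msupp0 big_nil. Qed.

Lemma mnormD p q : mnorm (p + q) <= mnorm p + mnorm q.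
Proof.
have us := undup_uniq (msupp p ++ msupp q).
rewrite (mnormE us) => [|m]; last by rewrite mem_undup; exact: msuppD_le.
apply: le_trans (lerD (sum_mcoeff_le_mnorm p us) (sum_mcoeff_le_mnorm q us)).
rewrite -big_split; apply: ler_sum => m _ /=.
by rewrite -mulrDl ler_wpM2r ?exprn_ge0 // mcoeffD ler_normD.
Qed.

Lemma mnorm_sum I (t : seq I) (P : pred I) (G : I -> poly_n) :
  mnorm (\sum_(i <- t | P i) G i) <= \sum_(i <- t | P i) mnorm (G i).
Proof.
elim/big_ind2: _ => [|a b c d ab cd|//]; first by rewrite mnorm0.
by apply: le_trans (mnormD _ _) _; apply: lerD.
Qed.

Lemma mnorm_monomial c m : mnorm (c *: mpolyX R m) = `|c| * r ^+ mdeg m.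
Proof.
rewrite (@mnormE _ [:: m]) ?big_seq1 ?mcoeffZ ?mcoeffX ?eqxx ?mulr1 // => m'.
by move=> /msuppZ_le; rewrite msuppX.
Qed.

Lemma mnormM p q : mnorm (p * q) <= mnorm p * mnorm q.
Proof.
rewrite mpolyME; apply: le_trans (mnorm_sum _ _ _) _.
rewrite big_allpairs /= [X in _ <= X * _]/mnorm mulr_suml; apply: ler_sum => m _.
rewrite mulr_sumr; apply: ler_sum => m' _.
by rewrite mnorm_monomial mdegD exprD normrM mulrACA.
Qed.

Lemma mnormC c : mnorm (mpolyC n c) = `|c|.
Proof.
rewrite (@mnormE _ [:: mnm0]) ?big_seq1 ?mcoeffC ?eqxx ?mulr1 ?mdeg0 ?expr0 ?mulr1 // => m.
by rewrite mcoeff_msupp mcoeffC inE; case: (m == mnm0) => //=; rewrite mulr0 eqxx.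
Qed.

Lemma mnormZ c p : mnorm (c *: p) <= `|c| * mnorm p.
Proof. by rewrite -mul_mpolyC; apply: le_trans (mnormM _ _) _; rewrite mnormC. Qed.

Lemma mnormN p : mnorm (- p) = mnorm p.
Proof.
rewrite /mnorm (perm_big _ (msuppN p)); apply: eq_bigr => m _.
by rewrite mcoeffN normrN.
Qed.

Lemma mnormX p k : mnorm (p ^+ k) <= mnorm p ^+ k.
Proof.
elim: k => [|k IH]; first by rewrite !expr0 (mnormC 1) normr1.
by rewrite !exprS; apply: le_trans (mnormM _ _) _; rewrite ler_wpM2l ?mnorm_ge0.
Qed.

Lemma meval_le_mnorm (v : 'I_n -> R) p : (forall i, `|v i| <= r) -> `|meval v p| <= mnorm p.
Proof.
move=> vr; rewrite mevalE; apply: le_trans (ler_norm_sum _ _ _) _; apply: ler_sum => m _.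
rewrite normrM ler_wpM2l // normr_prod mdegE -prodrXr; apply: ler_prod => i _.
by rewrite normrX exprn_ge0 //= lerXn2r ?nnegrE.
Qed.
End WeightedNorm.

(** Without a constant term every monomial gains a factor r. All smallness in the iteration comes
    from here. *)
Lemma mnorm_vanishing (R : realFieldType) n (r : R) (p : mpoly n R) :
  0 <= r <= 1 -> mcoeff mnm0 p = 0 -> mnorm r p <= r * mnorm 1 p.
Proof.
move=> /andP[r0 r1] p0; rewrite /mnorm mulr_sumr; apply: ler_sum => m _.
have [->|m0] := eqVneq m mnm0; first by rewrite p0 normr0 !mul0r mulr0.
rewrite expr1n mulr1 mulrC ler_wpM2r //.
move: m0; rewrite -mdeg_eq0; case: (mdeg m) => // d _.
by rewrite exprS ler_piMr // exprn_ile1.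
Qed.

Lemma mnorm_le (R : realFieldType) n (r r' : R) (p : mpoly n R) :
  0 <= r <= r' -> mnorm r p <= mnorm r' p.
Proof.
move=> /andP[r0 rr']; apply: ler_sum => m _; rewrite ler_wpM2l //.
by rewrite lerXn2r ?nnegrE // (le_trans r0).
Qed.

Lemma exists_half_pow_lt (R : realType) (A e : R) : 0 < e -> exists N, A / 2 ^+ N < e.
Proof.
move=> e0; have [A0|A0] := leP A 0.
  by exists 0%N; rewrite expr0 divr1 (le_lt_trans A0).
exists (Num.bound (A / e)); have := archi_boundP (ltW (divr_gt0 A0 e0)).
set N := Num.bound _; rewrite ltr_pdivrMr // ltr_pdivrMr ?exprn_gt0 // mulrC => h.
by apply: lt_le_trans h _; rewrite ler_pM2l // -natrX ler_nat ltnW // ltn_expl.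
Qed.

Lemma le0_half_pow (R : realType) (A e : R) : (forall N, e <= A / 2 ^+ N) -> e <= 0.
Proof.
move=> h; rewrite leNgt; apply/negP => e0.
by have [N] := exists_half_pow_lt A e0; rewrite ltNge h.
Qed.

(** The intervals of radius A / 2^N around u N meet pairwise, so the supremum of their left ends
    lies in all of them. *)
Lemma geometric_cauchy (R : realType) (u : nat -> R) (A : R) :
  (forall N M, (N <= M)%N -> `|u M - u N| <= A / 2 ^+ N) ->
  exists l, forall N, `|l - u N| <= A / 2 ^+ N.
Proof.
move=> uA; pose E : set R := [set x | exists N, x = u N - A / 2 ^+ N]%classic.
have A0 N : 0 <= A / 2 ^+ N by apply: le_trans (uA N N _).
have cross N M : u N - A / 2 ^+ N <= u M + A / 2 ^+ M.
  have [NM|/ltnW MN] := leqP N M.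
    by have := uA N M NM; have := A0 M; rewrite ler_norml => ? /andP[? _]; lra.
  by have := uA M N MN; have := A0 N; rewrite ler_norml => ? /andP[_ ?]; lra.
have E0 : (E !=set0)%classic by exists (u 0%N - A / 2 ^+ 0), 0%N.
have ubE M : ubound E (u M + A / 2 ^+ M) by move=> _ [N ->].
exists (sup E) => N; rewrite ler_distl; apply/andP; split.
  by apply: ub_le_sup; [exists (u 0%N + A / 2 ^+ 0); exact: ubE | exists N].
by apply: ge_sup.
Qed.

(** * Analytic dependence of a simple root on parameters *)

Section Newton.
Variables (R : realType) (n : nat) (q : {poly mpoly n R}).
Local Notation poly_n := (mpoly n R).
Local Notation d := (mcoeff mnm0 q`_1).
Hypothesis q0 : mcoeff mnm0 q`_0 = 0.
Hypothesis d0 : d != 0.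
Implicit Types (f g : poly_n).

(** Newton's step with the derivative frozen at the origin; only a number is inverted, so all
    iterates stay polynomials. *)
Definition newton f := f - d^-1 *: q.[f].

(** The divided difference of [newton] between f and g; a bound on it is the contraction
    constant. *)
Definition newton_slope f g :=
  1 - d^-1 *: \sum_(i < size q) q`_i * \sum_(l < i) f ^+ (i.-1 - l) * g ^+ l.

Lemma newtonB f g : newton f - newton g = (f - g) * newton_slope f g.
Proof.
rewrite /newton /newton_slope mulrBr mulr1 -scalerAr.
have -> : (f - g) * \sum_(i < size q) q`_i * \sum_(l < i) f ^+ (i.-1 - l) * g ^+ l =
    q.[f] - q.[g].
  rewrite !horner_coef -sumrB mulr_sumr; apply: eq_bigr => i _.
  by rewrite mulrCA -mulrBr subrXX.
by rewrite scalerBr !opprB [LHS]addrACA [RHS]addrACA (addrC (- g)).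
Qed.

Lemma newton_bounds : exists rho r0 K : R, [/\ 0 < rho, 0 < r0, 0 <= K &
  forall r, 0 <= r <= r0 -> [/\ mnorm r (newton 0) <= r * K, r * K <= rho / 2 &
    forall f g, mnorm r f <= rho -> mnorm r g <= rho -> mnorm r (newton_slope f g) <= 2^-1]].
Proof.
have qs : size q = (size q).-2.+2.
  have : (1 < size q)%N.
    by rewrite ltnNge; apply: contra d0 => szq; rewrite nth_default // mcoeff0.
  by case: (size q) => [|[|]].
set s := (size q).-2 in qs.
pose K := mnorm 1 (- (d^-1 *: q`_0)).
pose M1 := mnorm 1 (1 - d^-1 *: q`_1).
pose M2 := `|d^-1| * \sum_(i < s) mnorm 1 q`_i.+2 * i.+2%:R.
have K0 : 0 <= K by apply: mnorm_ge0.
have M10 : 0 <= M1 by apply: mnorm_ge0.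
have M20 : 0 <= M2.
  by rewrite mulr_ge0 // sumr_ge0 // => i _; rewrite mulr_ge0 // mnorm_ge0.
(* The contraction constant 1/2 is split in two quarters: [rho] makes the terms of degree at least 2
   small, [r0] the deviation of the linear coefficient from d. The last entry of [r0] keeps the
   iterates inside the ball of radius [rho]. *)
pose rho := (4 * (M2 + 1))^-1.
have rho0 : 0 < rho by rewrite invr_gt0; lra.
have rhoM2 : rho * M2 <= 4^-1.
  by rewrite /rho mulrC ler_pdivrMr; lra.
have rho1 : rho <= 1 by rewrite /rho invf_le1; lra.
pose r0 := Num.min 1 (Num.min (4 * (M1 + 1))^-1 (rho / (2 * (K + 1)))).
have r00 : 0 < r0.
  by rewrite !lt_min ltr01 invr_gt0 divr_gt0 //; lra.
exists rho, r0, K; split=> // r /andP[r_ge0]; rewrite !le_min => /and3P[r1 rM1 rK].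
have r01 : 0 <= r <= 1 by rewrite r_ge0.
split.
- have -> : newton 0 = - (d^-1 *: q`_0) by rewrite /newton horner_coef0 sub0r.
  by apply: mnorm_vanishing => //; rewrite mcoeffN mcoeffZ q0 mulr0 oppr0.
- apply: le_trans (ler_wpM2r K0 rK) _.
  have := ltW rho0; rewrite mulrAC ler_pdivrMr; last lra.
  by have := mulr_ge0 (ltW rho0) K0; lra.
move=> f g fr gr; rewrite /newton_slope.
rewrite -(big_mkord xpredT (fun i => q`_i * \sum_(l < i) f ^+ (i.-1 - l) * g ^+ l)) qs.
rewrite !big_nat_recl // big_mkord big_ord0 mulr0 add0r.
rewrite big_ord1 !expr0 !mulr1 scalerDr opprD addrA.
have first_part : mnorm r (1 - d^-1 *: q`_1) <= 4^-1.
  apply: le_trans (mnorm_vanishing r01 _) _.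
    by rewrite mcoeffB mcoeff1 eqxx mcoeffZ mulVf // subrr.
  apply: le_trans (ler_wpM2r M10 rM1) _.
  by rewrite mulrC ler_pdivrMr; lra.
have second_part : mnorm r (d^-1 *: \sum_(i < s) q`_i.+2 *
    \sum_(l < i.+2) f ^+ (i.+1 - l) * g ^+ l) <= 4^-1.
  apply: le_trans (mnormZ r_ge0 _ _) _; apply: le_trans _ rhoM2.
  rewrite /M2 mulrCA ler_wpM2l // mulr_sumr; apply: le_trans (mnorm_sum r_ge0 _ _ _) _.
  apply: ler_sum => i _; apply: le_trans (mnormM r_ge0 _ _) _.
  rewrite mulrCA; apply: ler_pM; rewrite ?mnorm_ge0 //; first exact: mnorm_le.
  apply: le_trans (mnorm_sum r_ge0 _ _ _) _.
  rewrite mulr_natr -[X in _ *+ X]card_ord -sumr_const; apply: ler_sum => l _.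
  apply: le_trans (mnormM r_ge0 _ _) _.
  have pow (p : poly_n) k : mnorm r p <= rho -> mnorm r (p ^+ k) <= rho ^+ k.
    move=> pr; apply: le_trans (mnormX r_ge0 _ _) _.
    by rewrite lerXn2r ?nnegrE ?mnorm_ge0 // ltW.
  apply: (le_trans (ler_pM (mnorm_ge0 r_ge0 _) (mnorm_ge0 r_ge0 _)
    (pow f (i.+1 - l)%N fr) (pow g l gr))).
  rewrite -exprD subnK; last by rewrite -ltnS.
  by rewrite exprS ler_piMr ?exprn_ile1 ?(ltW rho0).
apply: le_trans (mnormD r_ge0 _ _) _; rewrite mnormN; lra.
Qed.

(** The iteration from 0 contracts for all radii r up to r0 at once. Radius r gives the values and
    the estimate of phi by a multiple of r, radius r0 gives convergence of the coefficients. *)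
Lemma analytic_simple_root : exists (phi : ('I_n -> R) -> R) (c : multinom n -> R) (rho r0 K : R),
  [/\ 0 < rho, 0 < r0, 0 <= K &
  forall r, 0 <= r <= r0 -> forall t : 'I_n -> R, (forall i, `|t i| <= r) ->
    [/\ root (map_poly (meval t) q) (phi t), `|phi t| <= r * K * 2,
      forall u, `|u| <= rho -> root (map_poly (meval t) q) u -> u = phi t &
      forall e, 0 < e -> exists s0 : seq (multinom n), forall s, uniq s -> {subset s0 <= s} ->
        `|\sum_(m <- s) c m * \prod_i t i ^+ m i - phi t| <= e]].
Proof.
have [rho [r0 [K [rho0 r00 K0 bounds]]]] := newton_bounds.
pose xi N := iter N newton 0.
have half0 N : 0 < 2^-1 ^+ N :> R by rewrite exprn_gt0 // invr_gt0.
have xi_bounds r N : 0 <= r <= r0 ->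
    mnorm r (xi N) <= r * K * 2 * (1 - 2^-1 ^+ N) /\
    mnorm r (xi N.+1 - xi N) <= r * K * 2^-1 ^+ N.
  move=> rr; have [/andP[r_ge0 _] [n0 rK slope]] := (rr, bounds r rr).
  have rK0 : 0 <= r * K by rewrite mulr_ge0.
  elim: N => [|N [IH1 IH2]]; first by rewrite !expr0 subrr mulr0 mulr1 [xi 0%N]/= mnorm0 subr0.
  have split2 : 2^-1 ^+ N = 2 * 2^-1 ^+ N.+1 :> R by rewrite exprS; lra.
  have xiN1 : mnorm r (xi N.+1) <= r * K * 2 * (1 - 2^-1 ^+ N.+1).
    rewrite -[xi N.+1](subrK (xi N)); apply: le_trans (mnormD r_ge0 _ _) _.
    apply: le_trans (lerD IH2 IH1) _; rewrite split2; lra.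
  have le_rho M (x : poly_n) : mnorm r x <= r * K * 2 * (1 - 2^-1 ^+ M) -> mnorm r x <= rho.
    move=> h; apply: le_trans h _; have := mulr_ge0 rK0 (ltW (half0 M)); lra.
  split=> //; rewrite (newtonB (xi N.+1) (xi N)).
  apply: le_trans (mnormM r_ge0 _ _) _.
  apply: (le_trans (ler_pM (mnorm_ge0 r_ge0 _) (mnorm_ge0 r_ge0 _) IH2
    (slope _ _ (le_rho _ _ xiN1) (le_rho _ _ IH1)))).
  rewrite split2; lra.
have xi_cauchy r N M : 0 <= r <= r0 -> (N <= M)%N ->
    mnorm r (xi M - xi N) <= r * K * 2 / 2 ^+ N.
  move=> rr /subnK <-; have r_ge0 : 0 <= r by case/andP: rr.
  have rK0 : 0 <= r * K by rewrite mulr_ge0.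
  apply: (@le_trans _ _ (r * K * 2 * (2^-1 ^+ N - 2^-1 ^+ (M - N + N)))).
    elim: (M - N)%N => [|k IH]; first by rewrite add0n !subrr mnorm0 mulr0.
    rewrite -[xi _](subrK (xi (k + N)%N)) -addrA; apply: le_trans (mnormD r_ge0 _ _) _.
    have [_ h] := xi_bounds r (k + N)%N rr; apply: le_trans (lerD h IH) _.
    rewrite addSn [2^-1 ^+ (k + N).+1]exprS; lra.
  rewrite -exprVn ler_wpM2l ?mulr_ge0 // lerBlDr lerDl ltW //.
pose A := r0 * K * 2.
have r0r0 : 0 <= r0 <= r0 by rewrite ltW /=.
have meval_cauchy r (t : 'I_n -> R) N M : 0 <= r <= r0 -> (forall i, `|t i| <= r) ->
    (N <= M)%N -> `|meval t (xi M) - meval t (xi N)| <= r * K * 2 / 2 ^+ N.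
  move=> rr tr NM; rewrite -rmorphB; apply: le_trans _ (xi_cauchy r N M rr NM).
  by apply: meval_le_mnorm => //; case/andP: rr.
have /choice[phi phiP] (t : 'I_n -> R) : exists l, (forall i, `|t i| <= r0) ->
    forall N, `|l - meval t (xi N)| <= A / 2 ^+ N.
  have [tr|] := pselect (forall i, `|t i| <= r0); last by exists 0.
  have [|l lP] := @geometric_cauchy R (fun N => meval t (xi N)) A.
    by move=> N M; exact: meval_cauchy.
  by exists l.
(* Coefficients are scaled by r0^deg, which makes the error bound uniform in the monomial. *)
have /choice[l lP] (m : multinom n) : exists l, forall N,
    `|l - mcoeff m (xi N) * r0 ^+ mdeg m| <= A / 2 ^+ N.
  apply: geometric_cauchy => N M NM; apply: le_trans _ (xi_cauchy r0 N M r0r0 NM).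
  rewrite -mulrBl -mcoeffB normrM (ger0_norm (exprn_ge0 _ (ltW r00))).
  by have := @sum_mcoeff_le_mnorm _ _ r0 (ltW r00) (xi M - xi N) [:: m] isT; rewrite big_seq1.
exists phi, (fun m => l m / r0 ^+ mdeg m), rho, r0, K; split=> // r rr t tr.
have r_ge0 : 0 <= r by case/andP: rr.
have tr0 i : `|t i| <= r0 by apply: le_trans (tr i) _; case/andP: rr.
have [_ rK slope] := bounds r rr.
have rK0 : 0 <= r * K by rewrite mulr_ge0.
have xi_small N : mnorm r (xi N) <= r * K * 2.
  have [h _] := xi_bounds r N rr; apply: le_trans h _.
  by have := mulr_ge0 rK0 (ltW (half0 N)); lra.
have rK2 : r * K * 2 <= rho by lra.
have contraction (f g : poly_n) : mnorm r f <= rho -> mnorm r g <= rho ->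
    `|meval t (newton f) - meval t (newton g)| <= 2^-1 * `|meval t f - meval t g|.
  move=> fr gr; rewrite -!rmorphB newtonB rmorphM normrM mulrC.
  by rewrite ler_wpM2r // (le_trans _ (slope f g fr gr)) // meval_le_mnorm.
pose q_t := map_poly (meval t) q.
have meval_newton (f : poly_n) : meval t (newton f) = meval t f - d^-1 * q_t.[meval t f].
  by rewrite /newton rmorphB -mul_mpolyC rmorphM /= mevalC horner_map.
have phi_small : `|phi t| <= r * K * 2.
  rewrite -subr_le0; apply: (@le0_half_pow _ A) => N.
  rewrite lerBlDr -[phi t](subrK (meval t (xi N))); apply: le_trans (ler_normD _ _) _.
  rewrite lerD ?phiP //; apply: le_trans _ (xi_small N); exact: meval_le_mnorm.
have q_phi : q_t.[phi t] = 0.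
  have fixpt : phi t - d^-1 * q_t.[phi t] = phi t.
    apply/eqP; rewrite -subr_eq0 -normr_le0; apply: (@le0_half_pow _ A) => N.
    (* The number phi t enters the contraction estimate as a constant polynomial, whose norm is its
       absolute value. *)
    have := contraction (mpolyC n (phi t)) (xi N); rewrite mnormC meval_newton !mevalC.
    move=> /(_ (le_trans phi_small rK2) (le_trans (xi_small N) rK2)).
    have := phiP t tr0 N; have := phiP t tr0 N.+1.
    have -> : A / 2 ^+ N.+1 = A / 2 ^+ N / 2 by rewrite exprS invfM; ring.
    rewrite -[newton (xi N)]/(xi N.+1) (distrC (phi t) (meval t (xi N.+1))).
    move: (A / 2 ^+ N) => e h1 h2 h3; apply: le_trans (ler_distD (meval t (xi N.+1)) _ _) _.
    by apply: le_trans (lerD h3 h1) _; lra.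
  move/eqP: fixpt; rewrite -subr_eq0 addrAC subrr sub0r oppr_eq0 mulf_eq0 invr_eq0.
  by rewrite (negbTE d0) => /eqP.
split=> //; first exact/rootP.
- move=> u u_rho /rootP u0; have := contraction (mpolyC n u) (mpolyC n (phi t)).
  rewrite !mnormC !meval_newton !mevalC => /(_ u_rho (le_trans phi_small rK2)).
  rewrite u0 q_phi !mulr0 !subr0 => h; apply/eqP; rewrite -subr_eq0 -normr_le0; lra.
move=> e e0; have [N Ne] := exists_half_pow_lt A (divr_gt0 e0 (ltr0Sn R 1)).
(* Once s contains the support of the iterate, the iterate is a partial sum over s. Half of e is
   spent on its distance to phi t, the other half on the difference of coefficients. *)
exists (msupp (xi N)) => s us sub.
have xiE : meval t (xi N) = \sum_(m <- s) mcoeff m (xi N) * \prod_i t i ^+ m i.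
  by rewrite mevalE (sum_msupp_superset us sub) // => m /memN_msupp_eq0 ->; rewrite mul0r.
rewrite -[X in `|X - _|](subrK (meval t (xi N))) -addrA.
apply: le_trans (ler_normD _ _) _; rewrite [e]splitr lerD //; last first.
  by rewrite distrC (le_trans (phiP t tr0 N)) // ltW.
apply: le_trans _ (ltW Ne); rewrite xiE -sumrB.
apply: (@le_trans _ _ (\sum_(m <- s) `|l m - mcoeff m (xi N) * r0 ^+ mdeg m|)).
  apply: le_trans (ler_norm_sum _ _ _) _; apply: ler_sum => m _.
  have r0m : 0 < r0 ^+ mdeg m by rewrite exprn_gt0.
  have -> : l m / r0 ^+ mdeg m * \prod_i t i ^+ m i - mcoeff m (xi N) * \prod_i t i ^+ m i =
      (l m - mcoeff m (xi N) * r0 ^+ mdeg m) * (\prod_i t i ^+ m i / r0 ^+ mdeg m).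
    by field; rewrite gt_eqF.
  rewrite normrM ler_piMr // normrM normfV (gtr0_norm r0m) ler_pdivrMr // mul1r.
  rewrite normr_prod mdegE -prodrXr; apply: ler_prod => i _.
  by rewrite normrX exprn_ge0 //= lerXn2r ?nnegrE // ltW.
(* The l1 estimate between iterates passes to the limit coefficients: s is fixed, so replacing them
   by those of the iterate M + N costs at most |s| A / 2^M, for arbitrary M. *)
rewrite -subr_le0; apply: (@le0_half_pow _ ((size s)%:R * A)) => M.
rewrite lerBlDr.
apply: (@le_trans _ _ (\sum_(m <- s) (A / 2 ^+ M +
    `|mcoeff m (xi (M + N)%N - xi N)| * r0 ^+ mdeg m))); last first.
  rewrite big_split /= lerD //.
    by rewrite big_const_seq count_predT iter_addr_0 -[_ *+ size s]mulr_natl mulrA.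
  rewrite /A; apply: (le_trans _ (xi_cauchy r0 N (M + N)%N r0r0 (leq_addl _ _))).
  exact: (sum_mcoeff_le_mnorm (ltW r00)).
apply: ler_sum => m _; rewrite -[l m](subrK (mcoeff m (xi (M + N)%N) * r0 ^+ mdeg m)) -addrA.
apply: le_trans (ler_normD _ _) _; apply: lerD.
  apply: le_trans (lP m (M + N)%N) _; rewrite ler_wpM2l ?mulr_ge0 ?(ltW r00) //.
  by rewrite lef_pV2 ?posrE ?exprn_gt0 // ler_weXn2l ?leq_addr // ler1n.
by rewrite -mulrBl -mcoeffB normrM (ger0_norm (exprn_ge0 _ (ltW r00))).
Qed.
End Newton.

(** * Operations on analytic functions *)

Section AnalyticAt.
Variables (R : realType) (n : nat).
Implicit Types (f g : 'rV[R]_n -> R[i]) (a b : 'rV[R]_n).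
Local Open Scope classical_set_scope.

Lemma normc_real (x : R) : `|x%:C%C| = `|x|%:C%C :> R[i].
Proof.
have [x0|x0] := leP 0 x.
  by rewrite [in LHS]ger0_norm ?lecR // [in RHS]ger0_norm.
by rewrite [in LHS]ltr0_norm ?ltcR // [in RHS]ltr0_norm // rmorphN.
Qed.

(** Sup-distance below e, written coordinatewise so that it serves bare coordinate functions and
    matches the neighbourhoods of row vectors. *)
Definition uclose n (R : realType) (e : R) (x y : 'I_n -> R) := forall k, `|x k - y k| < e.

Lemma near_rowP (P : set 'rV[R]_n) a :
  (\forall b \near a, P b) <-> exists2 e, 0 < e & forall b, uclose e (b 0) (a 0) -> P b.
Proof.
split=> [/nbhs_ballP[e /= e0 eP]|[e e0 eP]].
  exists e => // b ba; apply: eP; split=> // i j.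
  by rewrite ord1 /ball /= distrC ba.
apply/nbhs_ballP; exists e => // b [_ ab]; apply: eP => k.
by have := ab 0 k; rewrite /ball /= distrC.
Qed.

#[local] Existing Instance totally_filter.

Lemma analytic_at_near f g a : (\forall b \near a, f b = g b) ->
  analytic_at f a -> analytic_at g a.
Proof. by move=> fg [c cf]; exists c; apply: filterS2 fg cf => b <-. Qed.

Lemma analytic_atB f g a : analytic_at f a -> analytic_at g a ->
  analytic_at (fun b => f b - g b) a.
Proof.
move=> [c cf] [d dg]; exists (fun m => c m - d m); apply: filterS2 cf dg => b cf dg.
have -> : partial_sum (power_series_term (fun m => c m - d m) a b) =
    (fun A => partial_sum (power_series_term c a b) A - partial_sum (power_series_term d a b) A).
  apply/funext => A; rewrite /partial_sum -sumrB; apply: eq_bigr => m _.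
  by rewrite /power_series_term mulrBl.
exact: (@cvgB (R[i]) (R[i]^o) _ totally _ _ _ _ _ cf dg).
Qed.

Lemma analytic_at_cst (k : R[i]) a : analytic_at (fun=> k) a.
Proof.
pose m0 : {ffun 'I_n -> nat} := [ffun=> 0%N].
exists (fun m => if m == m0 then k else 0); apply: (@filterE _ (nbhs a)) => b.
apply: cvg_near_cst; exists [fset m0]%fset => // A /=; rewrite fsub1set => m0A.
rewrite /partial_sum (bigD1 [` m0A]%fset) //= big1 ?addr0 => [|m mm0].
  by rewrite /power_series_term eqxx big1 ?mulr1 // => i _; rewrite ffunE expr0.
rewrite /power_series_term; case: eqP => [e|_]; last by rewrite mul0r.
by case/eqP: mm0; apply: val_inj.
Qed.

Lemma analytic_at_of_series (phi : ('I_n -> R) -> R) (c : multinom n -> R) r0 a : 0 < r0 ->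
  (forall t : 'I_n -> R, (forall i, `|t i| <= r0) ->
    forall e, 0 < e -> exists s0 : seq (multinom n), forall s, uniq s -> {subset s0 <= s} ->
      `|\sum_(m <- s) c m * \prod_i t i ^+ m i - phi t| <= e) ->
  analytic_at (fun b => (phi (fun i => (b - a) 0 i))%:C%C) a.
Proof.
move=> r00 series.
pose to_m (m : {ffun 'I_n -> nat}) : multinom n := Multinom (mktuple m).
pose of_m (m : multinom n) : {ffun 'I_n -> nat} := [ffun i => m i].
have to_mE m i : to_m m i = m i by rewrite /fun_of_multinom /= tnth_mktuple.
have of_mK : cancel of_m to_m.
  by move=> m; apply/mnmP => i; rewrite to_mE ffunE.
have to_mK : cancel to_m of_m by move=> m; apply/ffunP => i; rewrite ffunE to_mE.
exists (fun m => (c (to_m m))%:C%C); apply/near_rowP; exists r0 => // b ba.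
set t := fun i => (b - a) 0 i.
have tr i : `|t i| <= r0 by rewrite /t !mxE ltW.
apply/cvgrPdist_le => e e0.
have eE : e = (complex.Re e)%:C%C by rewrite RRe_real // gtr0_real.
have e'0 : 0 < complex.Re e by move: e0; rewrite eE ltcR.
have [s0 s0P] := series t tr _ e'0.
exists [fset of_m m | m in s0]%fset => // A /= sA.
have -> : partial_sum (power_series_term (fun m => (c (to_m m))%:C%C) a b) A =
    (\sum_(m <- map to_m A) c m * \prod_i t i ^+ m i)%:C%C.
  rewrite big_map raddf_sum big_seq_fsetE; apply: eq_bigr => m _; rewrite /power_series_term /= rmorphM.
  congr (_ * _); rewrite rmorph_prod; apply: eq_bigr => i _.
  by rewrite mxE to_mE rmorphXn.
rewrite -rmorphB normc_real eE lecR distrC; apply: s0P.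
  by rewrite map_inj_uniq ?fset_uniq //; exact: can_inj to_mK.
move=> m ms; apply/mapP; exists (of_m m); rewrite ?of_mK //.
by apply: (fsubsetP sA); apply: in_imfset.
Qed.
End AnalyticAt.

(** * Characteristic polynomials with coefficients polynomial in the parameters *)

Section ScaledCharPoly.
Variables (N : nat).

(** For M = d M' this is d^N times the characteristic polynomial of M', written without dividing by
    d. *)
Definition scaled_char_poly (K : comNzRingType) (d : K) (M : 'M[K]_N) : {poly K} :=
  \det ((d%:P * 'X)%:M - map_mx polyC M).

Lemma map_scaled_char_poly (K L : comNzRingType) (f : {rmorphism K -> L}) d (M : 'M[K]_N) :
  map_poly f (scaled_char_poly d M) = scaled_char_poly (f d) (map_mx f M).
Proof.
rewrite /scaled_char_poly -det_map_mx; congr (\det _); apply/matrixP => i j.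
by rewrite !mxE rmorphB /= map_polyC rmorphMn rmorphM /= map_polyC map_polyX.
Qed.

Lemma scaled_char_polyZ (K : comNzRingType) (d : K) (M : 'M[K]_N) :
  scaled_char_poly d (d *: M) = d ^+ N *: char_poly M.
Proof.
rewrite /scaled_char_poly -mul_polyC rmorphXn -detZ; congr (\det _).
rewrite /char_poly_mx scalerBr scale_scalar_mx; congr (_ - _).
by apply/matrixP => i j; rewrite !mxE polyCM.
Qed.
End ScaledCharPoly.

Lemma mcoeff_mnm0 (R : comNzRingType) n (p : mpoly n R) : mcoeff mnm0 p = meval (fun=> 0) p.
Proof.
rewrite mevalE.
have zero m : \prod_(i < n) (0 : R) ^+ fun_of_multinom m i = (m == mnm0)%:R.
  have [->|m0] := eqVneq m mnm0; first by rewrite big1 // => i _; rewrite mnmE expr0.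
  have [i mi] : exists i, m i != 0%N.
    apply/existsP; apply: contraNT m0 => /existsPn mz; apply/eqP/mnmP => i.
    by rewrite mnmE; apply/eqP; have := mz i; rewrite negbK.
  by rewrite (bigD1 i) //= expr0n (negbTE mi) mul0r.
under eq_bigr => m _ do rewrite zero.
have [p0|p0] := boolP (mnm0 \in msupp p).
  rewrite (bigD1_seq mnm0) ?msupp_uniq //= eqxx mulr1 big1 ?addr0 // => m /negbTE ->.
  by rewrite mulr0.
rewrite (memN_msupp_eq0 p0) big_seq big1 // => m mp; case: eqP => [e|_]; last by rewrite mulr0.
by move: p0; rewrite -e mp.
Qed.

Section LocalRoot.
Variables (R : realType) (n : nat) (a : 'I_n -> R).
Local Notation N := #|middle_level n|.
Implicit Types (t xi : 'I_n -> R).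

Definition moving_point (k : 'I_n) : mpoly n R := mpolyC n (a k) + mpolyX R (mnm1 k).

Definition moving_gap (p : 'I_n * 'I_n) := moving_point p.1 - moving_point p.2.

Definition gap_product := \prod_(p : 'I_n * 'I_n | p.1 != p.2) moving_gap p.

Definition gap_cofactor k l := \prod_(p : 'I_n * 'I_n | (p.1 != p.2) && (p != (k, l))) moving_gap p.

(** The matrix of T_k at the moving points, multiplied by the product of all gaps to clear its
    denominators. *)
Definition gaudin_pmx k : 'M[mpoly n R]_N := \matrix_(i < N, j < N)
  \sum_(l | l != k) gap_cofactor k l *
  ((enum_val i == enum_val j)%:R - (tperm k l @: (enum_val i : {set 'I_n}) == enum_val j)%:R).

Lemma meval_moving_gap t k l : meval t (moving_gap (k, l)) = (a k + t k) - (a l + t l).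
Proof. by rewrite /moving_gap /moving_point !rmorphB !rmorphD /= !mevalC !mevalXU. Qed.

Lemma gap_productE k l : k != l -> gap_product = moving_gap (k, l) * gap_cofactor k l.
Proof. by move=> kl; rewrite /gap_product (bigD1 (k, l)). Qed.

Lemma meval_gap_product_neq0 t : injective (fun k => a k + t k) -> meval t gap_product != 0.
Proof.
move=> inj; rewrite rmorph_prod; apply/prodf_neq0 => -[k l] /= kl.
by rewrite meval_moving_gap subr_eq0 (inj_eq inj).
Qed.

Lemma meval_gaudin_pmx t k : injective (fun k => a k + t k) ->
  map_mx (meval t) (gaudin_pmx k) = meval t gap_product *: gaudin_mx (fun k => a k + t k) k.
Proof.
move=> inj; apply/matrixP => i j; rewrite !mxE rmorph_sum mulr_sumr [RHS](bigD1 k) //=.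
rewrite gap_invii mul0r mulr0 add0r; apply: eq_bigr => l lk.
rewrite rmorphM rmorphB !rmorph_nat mulrA; congr (_ * _).
rewrite (@gap_productE k l) 1?eq_sym // rmorphM /= meval_moving_gap mulrAC mulfV ?mul1r //.
by rewrite subr_eq0 (inj_eq inj) eq_sym.
Qed.

Definition moving_char_poly xi : {poly mpoly n R} :=
  scaled_char_poly gap_product (\sum_k mpolyC n (xi k) *: gaudin_pmx k).

Lemma meval_moving_char_poly xi t : injective (fun k => a k + t k) ->
  map_poly (meval t) (moving_char_poly xi) =
  meval t gap_product ^+ N *: char_poly (\sum_k xi k *: gaudin_mx (fun k => a k + t k) k).
Proof.
move=> inj; rewrite map_scaled_char_poly -scaled_char_polyZ; congr (scaled_char_poly _ _).
apply/matrixP => i j; rewrite mxE summxE rmorph_sum mxE summxE mulr_sumr; apply: eq_bigr => k _.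
have /matrixP/(_ i j) := meval_gaudin_pmx k inj.
rewrite [in RHS]mxE [LHS]mxE => e; rewrite [in LHS]mxE rmorphM /= mevalC e [in RHS]mxE.
by rewrite mulrCA.
Qed.

Lemma moving_char_poly_root xi t u : injective (fun k => a k + t k) ->
  root (map_poly (meval t) (moving_char_poly xi)) u =
  root (char_poly (\sum_k xi k *: gaudin_mx (fun k => a k + t k) k)) u.
Proof.
move=> inj; rewrite meval_moving_char_poly // rootZ // expf_neq0 //.
exact: meval_gap_product_neq0.
Qed.

(* The root [u0] is moved to 0 so that [analytic_simple_root] applies. *)
Lemma analytic_eigenvalue xi (u0 : R) (v : 'I_N -> R) i0 : injective a ->
  char_poly (\sum_k xi k *: gaudin_mx a k) = \prod_i ('X - (v i)%:P) ->
  v i0 = u0 -> (forall i, i != i0 -> v i != u0) ->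
  exists (phi : ('I_n -> R) -> R) (c : multinom n -> R) (rho r0 K : R),
  [/\ 0 < rho, 0 < r0, 0 <= K &
  forall r, 0 <= r <= r0 -> forall t : 'I_n -> R, (forall i, `|t i| <= r) ->
    injective (fun k => a k + t k) ->
    let p := char_poly (\sum_k xi k *: gaudin_mx (fun k => a k + t k) k) in
    [/\ root p (u0 + phi t), `|phi t| <= r * K * 2,
      forall u, `|u - u0| <= rho -> root p u -> u = u0 + phi t &
      forall e, 0 < e -> exists s0 : seq (multinom n), forall s, uniq s -> {subset s0 <= s} ->
        `|\sum_(m <- s) c m * \prod_i t i ^+ m i - phi t| <= e]].
Proof.
move=> a_inj char_a vi0 vi; pose q := moving_char_poly xi \Po ('X + (mpolyC n u0)%:P).
have q_root t u : injective (fun k => a k + t k) -> root (map_poly (meval t) q) u =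
    root (char_poly (\sum_k xi k *: gaudin_mx (fun k => a k + t k) k)) (u0 + u).
  move=> inj; rewrite -moving_char_poly_root // /q map_comp_poly rmorphD /= map_polyX.
  by rewrite map_polyC /= mevalC !rootE horner_comp !hornerE addrC.
have a0 : (fun k => a k + (fun=> 0) k) = a by apply/funext => k; rewrite addr0.
have inj0 : injective (fun k => a k + (fun=> 0) k) by rewrite a0.
pose q0 := map_poly (meval (fun=> 0)) q.
have q0E : q0 = (meval (fun=> 0) gap_product ^+ N *: \prod_i ('X - (v i)%:P)) \Po ('X + u0%:P).
  rewrite /q0 /q map_comp_poly meval_moving_char_poly // a0 char_a rmorphD /= map_polyX.
  by rewrite map_polyC /= mevalC.
have coef0 : mcoeff mnm0 q`_0 = 0.
  rewrite mcoeff_mnm0 -coef_map -/q0 -horner_coef0 q0E horner_comp !hornerE.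
  by rewrite horner_prod (bigD1 i0) //= hornerXsubC vi0 subrr mul0r mulr0.
(* The derivative at the centre is a nonzero power of the gap product times the product of the
   differences between u0 and the other roots. *)
have coef1 : mcoeff mnm0 q`_1 != 0.
  rewrite mcoeff_mnm0 -coef_map -/q0.
  have -> : q0`_1 = q0^`().[0] by rewrite horner_coef0 coef_deriv mulr1n.
  rewrite q0E deriv_comp derivD derivX derivC addr0 mulr1 horner_comp hornerD hornerX hornerC.
  rewrite add0r derivZ hornerZ mulf_neq0 ?expf_neq0 ?meval_gap_product_neq0 //.
  rewrite (bigD1 i0) //= derivM derivXsubC mul1r hornerD hornerM hornerXsubC vi0 subrr mul0r.
  rewrite addr0 horner_prod; apply/prodf_neq0 => i ii0.
  by rewrite hornerXsubC subr_eq0 eq_sym vi.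
have [phi [c [rho [r0 [K [rho0 r00 K0 phiP]]]]]] := analytic_simple_root coef0 coef1.
exists phi, c, rho, r0, K; split=> // r rr t tr inj /=.
have [h1 h2 h3 h4] := phiP r rr t tr; split=> //; first by rewrite -q_root.
move=> u urho u_root; rewrite -(h3 (u - u0)) ?q_root // addrC subrK //.
Qed.
End LocalRoot.

(** * Common radii and generic linear functionals *)

Lemma fin_common_radius (R : realFieldType) (T : finType) (P : T -> R -> Prop) :
  (forall i e e', 0 < e' <= e -> P i e -> P i e') ->
  (forall i, exists2 e, 0 < e & P i e) -> exists2 e, 0 < e & forall i, P i e.
Proof.
move=> mono ex; have /fin_all_exists[f fP] i : exists e, 0 < e /\ P i e.
  by have [e] := ex i; exists e.
have sum0 (Q : pred T) : 0 <= \sum_(i | Q i) (f i)^-1.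
  by apply: sumr_ge0 => i _; rewrite invr_ge0 ltW //; case: (fP i).
(* A positive lower bound of finitely many radii that also makes sense for an empty family. *)
exists (1 + \sum_i (f i)^-1)^-1 => [|i]; first by rewrite invr_gt0 ltr_pwDl.
have [fi0 Pi] := fP i; apply: mono Pi; rewrite invr_gt0 ltr_pwDl //=.
rewrite invf_ple ?posrE ?ltr_pwDl // (bigD1 i) //=.
by have := sum0 (fun j => j != i); lra.
Qed.

Lemma exists_nonroot (R : numFieldType) (p : {poly R}) : p != 0 -> exists u, ~~ root p u.
Proof.
move=> p0; apply: contrapT => all_root.
pose rs := [seq i%:R | i <- iota 0 (size p)] : seq R.
have : (size rs < size p)%N.
  apply: max_poly_roots => //.
    by apply/allP => u _; apply: contrapT => /negP nr; apply: all_root; exists u.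
  by rewrite map_inj_uniq ?iota_uniq // => i j /eqP; rewrite eqr_nat => /eqP.
by rewrite size_map size_iota ltnn.
Qed.

(* A generic point of the moment curve lies on none of finitely many hyperplanes. *)
Lemma separating_functional (R : realFieldType) n (T : finType) (D : T -> 'I_n -> R) :
  exists xi : 'I_n -> R, forall s, (exists k, D s k != 0) ->
    \sum_k xi k * D s k != 0 /\ forall k, \sum_j xi j * D s j + D s k != 0.
Proof.
pose p s : {poly R} := \sum_k D s k *: 'X^(k.+1).
have coef_p s (k : 'I_n) : (p s)`_k.+1 = D s k.
  rewrite coef_sum (bigD1 k) //= coefZ coefXn eqxx mulr1 big1 ?addr0 // => j jk.
  by rewrite coefZ coefXn eqSS (inj_eq val_inj) eq_sym (negbTE jk) mulr0.
have pC_neq0 s c : (exists k, D s k != 0) -> p s + c%:P != 0.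
  move=> [k Dk]; apply: contraNneq Dk => /(congr1 (fun q : {poly R} => q`_k.+1)).
  by rewrite coefD coefC coef_p addr0 coef0 => ->.
pose q s := if p s == 0 then 1 else p s * \prod_k (p s + (D s k)%:P).
have [|u] := @exists_nonroot _ (\prod_s q s).
  apply/prodf_neq0 => s _; rewrite /q; case: ifPn => [_|ps]; first exact: oner_neq0.
  have Ds : exists k, D s k != 0.
    apply/existsP; apply: contraNT ps => /existsPn D0; rewrite /p big1 // => k _.
    by have := D0 k; rewrite negbK => /eqP ->; rewrite scale0r.
  by rewrite mulf_neq0 //; apply/prodf_neq0 => k _; apply: pC_neq0.
rewrite rootE horner_prod => /prodf_neq0 qu; exists (fun k : 'I_n => u ^+ k.+1) => s Ds.
have ps0 : p s != 0 by have := pC_neq0 s 0 Ds; rewrite polyC0 addr0.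
have := qu s isT; rewrite /q (negbTE ps0).
rewrite hornerM horner_prod mulf_eq0 negb_or => /andP[p0 /prodf_neq0 pk].
have pE : \sum_(k < n) u ^+ k.+1 * D s k = (p s).[u].
  by rewrite horner_sum; apply: eq_bigr => k _; rewrite hornerZ hornerXn mulrC.
by split=> [|k]; rewrite pE //; have := pk k isT; rewrite hornerD hornerC.
Qed.

(** * Solutions near a given parameter point *)

Section Neighbourhood.
Variables (R : realType) (n : nat) (a : 'I_n -> R).
Hypothesis a_inj : injective a.
Local Notation N := #|middle_level n|.
Implicit Types (b x y xi : 'I_n -> R).

Lemma ucloseW e e' x y : e' <= e -> uclose e' x y -> uclose e x y.
Proof. by move=> ee xy k; apply: lt_le_trans (xy k) ee. Qed.

Lemma uclose_sym e x y : uclose e x y -> uclose e y x.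
Proof. by move=> xy k; rewrite distrC. Qed.

Lemma gap_lower_bound : exists2 g, 0 < g & forall b, uclose g b a ->
  forall k l, k != l -> g <= `|b k - b l|.
Proof.
(* A third of the gap: two points moving by less than g each still leave g between them. *)
have [||g g0 gP] := @fin_common_radius R ('I_n * 'I_n)%type
  (fun p e => p.1 != p.2 -> 3 * e <= `|a p.1 - a p.2|).
- by move=> p e e' /andP[_ ee'] h /h; apply: le_trans; rewrite ler_pM2l.
- move=> [k l] /=; have [->|kl] := eqVneq k l; first by exists 1.
  exists (`|a k - a l| / 3) => [|_]; last by lra.
  by rewrite divr_gt0 // normr_gt0 subr_eq0 (inj_eq a_inj).
exists g => // b ba k l kl; have := gP (k, l) kl => /= akl.
have := ba k; have := ba l; have := ler_distD (b k) (a k) (a l).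
have := ler_distD (b l) (b k) (a l); rewrite (distrC (a k) (b k)); lra.
Qed.

Lemma injective_near : exists2 r, 0 < r & forall b, uclose r b a -> injective b.
Proof.
have [g g0 gP] := gap_lower_bound; exists g => // b /gP gb k l bkl; apply/eqP.
by apply: contraT => /gb; rewrite bkl subrr normr0 leNgt g0.
Qed.

(** At a coordinate of largest modulus the equation bounds its square by a constant times the
    modulus itself. *)
Lemma solution_bounded : exists r B, [/\ 0 < r, 0 < B & forall b, uclose r b a ->
  forall x, gaudin_solution b x -> forall k, `|x k| <= B].
Proof.
have [g g0 gP] := gap_lower_bound; exists g, (1 + 2 * g^-1 *+ n); split=> //.
  by rewrite ltr_pwDl // mulrn_wge0 // mulr_ge0 // invr_ge0 ltW.
move=> b /gP gb x xsol k0.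
have [k _ kmax] := arg_maxP (fun k => `|x k|) (isT : xpredT k0).
apply: le_trans (kmax k0 isT) _.
have [xk0|xk0] := eqVneq (x k) 0.
  by rewrite xk0 normr0 addr_ge0 // mulrn_wge0 // mulr_ge0 // invr_ge0 ltW.
have xk_gt0 : 0 < `|x k| by rewrite normr_gt0.
rewrite -(ler_pM2r xk_gt0) -normrM -expr2 xsol; apply: le_trans (ler_norm_sum _ _ _) _.
apply: (@le_trans _ _ (\sum_(j < n) 2 * g^-1 * `|x k|)); last first.
  by rewrite sumr_const card_ord -[X in X <= _]mulrnAl ler_wpM2r // lerDr.
have -> : 2 * g^-1 * `|x k| = g^-1 * (2 * `|x k|) by ring.
apply: ler_sum => j _; rewrite normrM; apply: ler_pM => //.
  have [->|kj] := eqVneq k j; first by rewrite gap_invii normr0 invr_ge0 ltW.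
  by rewrite /gap_inv normfV lef_pV2 ?posrE ?gb // (lt_le_trans g0) ?gb.
apply: le_trans (ler_normB _ _) _; have /= := kmax j isT; lra.
Qed.

Lemma solution_root b x xi : injective b -> gaudin_solution b x ->
  root (char_poly (\sum_k xi k *: gaudin_mx b k)) (\sum_k xi k * x k).
Proof.
move=> b_inj xsol; have [X [_ Xall _ Xchar]] := gaudin_spectrum b_inj.
have [i ->] := Xall x xsol; rewrite Xchar rootE horner_prod (bigD1 i) //=.
by rewrite hornerXsubC subrr mul0r.
Qed.

Lemma root_solution b u xi : injective b ->
  root (char_poly (\sum_k xi k *: gaudin_mx b k)) u ->
  exists2 x, gaudin_solution b x & u = \sum_k xi k * x k.
Proof.
move=> b_inj; have [X [Xsol _ _ Xchar]] := gaudin_spectrum b_inj.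
rewrite Xchar rootE horner_prod => /eqP/eqP; rewrite prodf_seq_eq0 => /hasP[i _].
by rewrite hornerXsubC subr_eq0 => /eqP ->; exists (X i).
Qed.

Variable X : 'I_N -> 'I_n -> R.
Hypothesis Xchar : forall xi, char_poly (\sum_k xi k *: gaudin_mx a k) =
  \prod_i ('X - (\sum_k xi k * X i k)%:P).

Lemma shift_uclose e b : uclose e b a -> forall k, `|b k - a k| <= e.
Proof. by move=> ba k; apply: ltW. Qed.

(** The value u is a root of the polynomial at b, so the polynomial at a is small at u. If u were at
    distance e from all roots, that value would be at least [|d0| * e ^+ N]. *)
Lemma functional_near xi e : 0 < e -> exists2 r, 0 < r & forall b, uclose r b a ->
  forall x, gaudin_solution b x -> exists i, `|\sum_k xi k * x k - \sum_k xi k * X i k| < e.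
Proof.
move=> e0; have [r1 [B [r10 B0 Bbound]]] := solution_bounded.
have [r2 r20 inj2] := injective_near.
pose P := moving_char_poly a xi; pose M := \sum_k `|xi k| * B.
have M0 : 0 <= M by apply: sumr_ge0 => k _; rewrite mulr_ge0 // ltW.
pose P' i : mpoly n R := P`_i - mpolyC n (mcoeff mnm0 P`_i).
pose C := \sum_(i < size P) mnorm 1 (P' i) * M ^+ i.
have C0 : 0 <= C by apply: sumr_ge0 => i _; rewrite mulr_ge0 ?exprn_ge0 ?mnorm_ge0.
pose d0 := meval (fun=> 0) (gap_product a) ^+ N.
have d00 : 0 < `|d0|.
  rewrite normr_gt0 expf_neq0 // meval_gap_product_neq0 //.
  by move=> k l; rewrite !addr0 => /a_inj.
(* [C] bounds the change of the polynomial at u per unit of r; the last entry keeps this change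
   strictly below [|d0| * e ^+ N]. *)
pose r := Num.min 1 (Num.min r1 (Num.min r2 (`|d0| * e ^+ N / (C + 1)))).
have r0 : 0 < r by rewrite !lt_min ltr01 r10 r20 divr_gt0 ?mulr_gt0 ?exprn_gt0 ?ltr_wpDl.
exists r => // b ba x xsol; apply: contrapT => /forallNP far.
have : (r <= 1) && ((r <= r1) && ((r <= r2) && (r <= `|d0| * e ^+ N / (C + 1)))).
  by rewrite -!le_min.
move=> /and4P[rle1 rler1 rler2 rlee].
have b_inj := inj2 b (ucloseW rler2 ba); have xB := Bbound b (ucloseW rler1 ba) x xsol.
pose t k := b k - a k; set u := \sum_k xi k * x k in far.
have bE : (fun k => a k + t k) = b by apply/funext => k; rewrite addrC subrK.
have uM : `|u| <= M.
  apply: le_trans (ler_norm_sum _ _ _) _; apply: ler_sum => k _.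
  by rewrite normrM ler_wpM2l.
have Pt : (map_poly (meval t) P).[u] = 0.
  by apply/rootP; rewrite moving_char_poly_root ?bE //; apply: solution_root.
have P0 : e ^+ N * `|d0| <= `|(map_poly (meval (fun=> 0)) P).[u]|.
  rewrite meval_moving_char_poly; last by move=> k l; rewrite !addr0 => /a_inj.
  rewrite (_ : (fun k => a k + 0) = a); last by apply/funext => k; rewrite addr0.
  rewrite Xchar hornerZ normrM mulrC ler_wpM2l // horner_prod normr_prod.
  rewrite -[X in e ^+ X]card_ord -prodr_const; apply: ler_prod => i _.
  by rewrite (ltW e0) /= hornerXsubC leNgt; apply/negP/far.
have diff : `|(map_poly (meval (fun=> 0)) P).[u]| <= r * C.
  have -> : (map_poly (meval (fun=> 0)) P).[u] =
      (map_poly (meval (fun=> 0)) P).[u] - (map_poly (meval t) P).[u] by rewrite Pt subr0.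
  have hornerE s : (map_poly (meval s) P).[u] = \sum_(i < size P) meval s P`_i * u ^+ i.
    rewrite (@horner_coef_wide _ (size P)) ?size_poly //.
    by apply: eq_bigr => i _; rewrite coef_map.
  rewrite !hornerE -sumrB mulr_sumr; apply: le_trans (ler_norm_sum _ _ _) _.
  apply: ler_sum => i _; rewrite -mulrBl normrM mulrA; apply: ler_pM => //; last first.
    by rewrite normrX lerXn2r ?nnegrE.
  have -> : meval (fun=> 0) P`_i - meval t P`_i = - meval t (P' i).
    by rewrite /P' rmorphB /= mevalC mcoeff_mnm0 opprB.
  rewrite normrN; apply: (@le_trans _ _ (mnorm r (P' i))).
    by apply: meval_le_mnorm => [|k]; [exact: ltW | exact: shift_uclose].
  apply: mnorm_vanishing; first by rewrite (ltW r0).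
  by rewrite mcoeffB mcoeffC eqxx mulr1 subrr.
have := le_trans P0 diff; rewrite leNgt => /negP; apply.
apply: (@le_lt_trans _ _ (`|d0| * e ^+ N / (C + 1) * C)); first by rewrite ler_wpM2r.
rewrite mulrAC ltr_pdivrMr ?ltr_wpDl // (mulrC (e ^+ N)).
by rewrite ltr_pM2l ?mulr_gt0 ?exprn_gt0 // ltrDl.
Qed.

Lemma functional_uclose xi e x y : uclose e x y ->
  `|\sum_k xi k * x k - \sum_k xi k * y k| <= (\sum_k `|xi k|) * e.
Proof.
move=> xy; rewrite -sumrB mulr_suml; apply: le_trans (ler_norm_sum _ _ _) _.
by apply: ler_sum => k _; rewrite -mulrBr normrM ler_wpM2l // ltW.
Qed.

Lemma separation_gap (T : finType) (D : T -> 'I_n -> R) xi :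
  (forall s, (exists k, D s k != 0) -> \sum_k xi k * D s k != 0) ->
  exists2 g, 0 < g & forall s, `|\sum_k xi k * D s k| < g -> forall k, D s k = 0.
Proof.
move=> sep; have [||g g0 gP] := @fin_common_radius R T
    (fun s e => (exists k, D s k != 0) -> e <= `|\sum_k xi k * D s k|).
- by move=> s e e' /andP[_ ee'] h /h; apply: le_trans.
- move=> s; have [Ds|Ds] := pselect (exists k, D s k != 0); last by exists 1.
  by exists `|\sum_k xi k * D s k|; rewrite ?normr_gt0 ?sep.
exists g => // s Dg k; apply/eqP; apply: contraT => Dk.
by have := gP s (ex_intro _ k Dk); rewrite leNgt Dg.
Qed.

(** Applied to coordinate functionals, [functional_near] places each x k near some X (h k) k, but h
    k may vary with k. A functional separating all such mixed tuples from the genuine solutions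
    forces the tuple to be one X i. *)
Lemma solutions_near e : 0 < e -> exists2 r, 0 < r & forall b, uclose r b a ->
  forall x, gaudin_solution b x -> exists i, uclose e x (X i).
Proof.
move=> e0; pose G := {ffun 'I_n -> 'I_N}.
pose D (s : G * 'I_N) k := X (s.1 k) k - X s.2 k.
have [xi sep] := separating_functional D.
have [|g g0 gP] := @separation_gap _ D xi; first by move=> s /sep[].
pose S := \sum_k `|xi k|; have S0 : 0 <= S by apply: sumr_ge0.
pose e' := Num.min e (g / (2 * (S + 1))).
have e'0 : 0 < e' by rewrite lt_min e0 divr_gt0 // mulr_gt0 // ltr_wpDl.
have [|r1 r10 near_xi] := @functional_near xi (g / 2); first by rewrite divr_gt0.
have [||r2 r20 near_coord] := @fin_common_radius R 'I_n
    (fun k r => forall b, uclose r b a -> forall x, gaudin_solution b x ->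
       exists i, `|x k - X i k| < e').
- by move=> k r r' /andP[_ rr'] h b /(ucloseW rr'); apply: h.
- move=> k; have [r r0 h] := functional_near (fun j => (j == k)%:R) e'0.
  have pick (y : 'I_n -> R) : \sum_j (j == k)%:R * y j = y k.
    rewrite (bigD1 k) //= eqxx mul1r big1 ?addr0 // => j /negbTE ->.
    by rewrite mul0r.
  by exists r => // b ba x xsol; have [j jP] := h b ba x xsol; exists j; rewrite -!pick.
exists (Num.min r1 r2); first by rewrite lt_min r10.
move=> b ba x xsol.
have ba1 : uclose r1 b a by apply: ucloseW ba; rewrite ge_min lexx.
have ba2 : uclose r2 b a by apply: ucloseW ba; rewrite ge_min lexx orbT.
have [i xi_i] := near_xi b ba1 x xsol.
have /fin_all_exists[h hP] : forall k, exists j, `|x k - X j k| < e'.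
  by move=> k; apply: near_coord ba2 x xsol.
pose y k := X (h k) k; have xy : uclose e' x y by [].
have Dgi : `|\sum_k xi k * D (finfun h, i) k| < g.
  have -> : \sum_k xi k * D (finfun h, i) k = \sum_k xi k * y k - \sum_k xi k * X i k.
    by rewrite -sumrB; apply: eq_bigr => k _; rewrite /D /= ffunE mulrBr.
  apply: le_lt_trans (ler_distD (\sum_k xi k * x k) _ _) _.
  have : (\sum_k `|xi k|) * e' <= g / 2.
    apply: (@le_trans _ _ (S * (g / (2 * (S + 1))))).
      by rewrite ler_wpM2l // ge_min lexx orbT.
    by rewrite mulrA ler_pdivrMr ?mulr_gt0 ?ltr_wpDl //; lra.
  have := functional_uclose xi xy; rewrite distrC.
  move: xi_i; lra.
exists i; move=> k; have /eqP := gP _ Dgi k; rewrite /D /= ffunE subr_eq0 => /eqP <-.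
by apply: lt_le_trans (hP k) _; rewrite ge_min lexx.
Qed.

Lemma functional_branch i xi : (forall j, j != i ->
    \sum_k xi k * X j k != \sum_k xi k * X i k) ->
  exists phi : 'rV[R]_n -> R,
  [/\ analytic_at (fun b : 'rV[R]_n => (phi b)%:C%C) (\row_k a k),
      exists2 r, 0 < r & forall b : 'rV[R]_n, uclose r (b 0) a ->
        forall x, gaudin_solution (b 0) x -> uclose r x (X i) ->
        \sum_k xi k * x k = \sum_k xi k * X i k + phi b &
      forall e, 0 < e -> exists2 r, 0 < r & forall b, uclose r b a ->
        exists2 x, gaudin_solution b x &
          `|\sum_k xi k * x k - \sum_k xi k * X i k| <= e].
Proof.
move=> sep; have [phi [c [rho [r0 [K [rho_gt0 r0_gt0 K_ge0 phiP]]]]]] :=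
  analytic_eigenvalue a_inj (Xchar xi) (erefl (\sum_k xi k * X i k)) sep.
have [r1 r10 inj] := injective_near.
(* Half of [r1], because the bounds on t are weak inequalities and [uclose] is strict. *)
pose r2 := Num.min r0 (r1 / 2).
have r20 : 0 < r2 by rewrite lt_min r0_gt0 divr_gt0.
have r2r0 : r2 <= r0 by rewrite ge_min lexx.
have inj2 (t : 'I_n -> R) : (forall k, `|t k| <= r2) -> injective (fun k => a k + t k).
  move=> tr; apply: inj => k; rewrite addrC addKr; apply: le_lt_trans (tr k) _.
  by rewrite gt_min; apply/orP; right; lra.
pose t (b : 'rV[R]_n) k := (b - \row_k a k) 0 k.
have atE (b : 'rV[R]_n) : (fun k => a k + t b k) = b 0.
  by apply/funext => k; rewrite /t !mxE; ring.
have t_small r (b : 'rV[R]_n) : uclose r (b 0) a -> forall k, `|t b k| <= r.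
  by move=> ba k; rewrite /t !mxE ltW.
exists (fun b : 'rV[R]_n => phi (t b)); split.
- apply: (@analytic_at_of_series _ _ phi c r2) => // s sr.
  by have [] := phiP r2 _ s sr (inj2 s sr); rewrite ?(ltW r20).
- pose S := \sum_k `|xi k|; have S0 : 0 <= S by apply: sumr_ge0.
  exists (Num.min r2 (rho / (S + 1))).
    by rewrite lt_min r20 divr_gt0 // ltr_wpDl.
  move=> b ba x xsol xX.
  have br : forall k, `|t b k| <= r2.
    by apply: t_small; apply: ucloseW ba; rewrite ge_min lexx.
  have [|_ _ h _] := phiP r2 _ (t b) br (inj2 _ br); first by rewrite ltW.
  apply: h; last by rewrite atE; apply: solution_root => //; rewrite -atE; exact: inj2.
  apply: le_trans (functional_uclose xi xX) _.
  apply: (@le_trans _ _ (S * (rho / (S + 1)))).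
    by rewrite ler_wpM2l // ge_min lexx orbT.
  by rewrite mulrA ler_pdivrMr ?ltr_wpDl //; lra.
(* The estimate of phi by 2 r K holds for every small r, so r is taken with 2 r K at most e. *)
move=> e e0; pose r := Num.min r2 (e / (K * 2 + 1)).
have K2 : 0 < K * 2 + 1 by rewrite ltr_wpDl // mulr_ge0.
have r_gt0 : 0 < r by rewrite lt_min r20 divr_gt0.
exists r => // b ba; pose bv : 'rV[R]_n := \row_k b k.
have bvE : bv 0 = b by apply/funext => k; rewrite mxE.
have br : forall k, `|t bv k| <= r by apply: t_small; rewrite bvE.
have inj_b : injective (fun k => a k + t bv k).
  by apply: inj2 => k; apply: le_trans (br k) _; rewrite ge_min lexx.
have [|h1 h2 _ _] := phiP r _ (t bv) br inj_b.
  by rewrite (ltW r_gt0) (le_trans _ r2r0) // ge_min lexx.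
move: h1; rewrite atE bvE => /root_solution[|x xsol xE]; first by rewrite -bvE -atE.
exists x => //; rewrite -xE addrAC subrr add0r; apply: le_trans h2 _.
have : r <= e / (K * 2 + 1) by rewrite ge_min lexx orbT.
rewrite ler_pdivlMr // -mulrA => h; apply: le_trans _ h; rewrite ler_wpM2l ?(ltW r_gt0) //; lra.
Qed.

Hypothesis Xinj : injective X.

Lemma solution_branch i : exists (s : R) (phi : 'rV[R]_n -> 'I_n -> R),
  [/\ 0 < s, forall k, analytic_at (fun b : 'rV[R]_n => (phi b k)%:C%C) (\row_k a k),
      exists2 r, 0 < r & forall b : 'rV[R]_n, uclose r (b 0) a ->
        forall x, gaudin_solution (b 0) x -> uclose s x (X i) -> x = phi b &
      forall e, 0 < e -> exists2 r, 0 < r & forall b, uclose r b a ->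
        exists2 x, gaudin_solution b x & uclose e x (X i)].
Proof.
pose D (s : 'I_N * 'I_N) k := X s.1 k - X s.2 k.
have [xi sep] := separating_functional D.
have [|g g0 gP] := @separation_gap _ D xi; first by move=> s /sep[].
have Dneq0 j : j != i -> exists k, D (j, i) k != 0.
  move=> ji; apply/existsP; apply: contraNT ji => /existsPn Dz; apply/eqP/Xinj/funext => k.
  by apply/eqP; have := Dz k; rewrite negbK subr_eq0.
have sumD j zeta : \sum_k zeta k * X j k - \sum_k zeta k * X i k = \sum_k zeta k * D (j, i) k.
  by rewrite -sumrB; apply: eq_bigr => k _; rewrite mulrBr.
(* A coordinate functional need not separate solutions, but xi and xi plus the k-th coordinate both
   do; x k is the difference of their values. *)
pose xi_ (k l : 'I_n) := xi l + (l == k)%:R.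
have xi_E k y : \sum_l xi_ k l * y l = \sum_l xi l * y l + y k.
  under eq_bigr => l _ do rewrite mulrDl.
  rewrite big_split /=; congr (_ + _); rewrite (bigD1 k) //= eqxx mul1r big1 ?addr0 //.
  by move=> l /negbTE ->; rewrite mul0r.
have [|phi [phi_an [r0 r0_gt0 phiP] phi_ex]] := @functional_branch i xi.
  by move=> j /Dneq0 /sep[+ _]; rewrite -sumD subr_eq0.
have /fin_all_exists[psi psiP] : forall k, exists psi : 'rV[R]_n -> R,
  analytic_at (fun b : 'rV[R]_n => (psi b)%:C%C) (\row_k a k) /\
  exists2 r, 0 < r & forall b : 'rV[R]_n, uclose r (b 0) a ->
    forall x, gaudin_solution (b 0) x -> uclose r x (X i) ->
    \sum_l xi_ k l * x l = \sum_l xi_ k l * X i l + psi b.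
  move=> k; have [|psi [h1 h2 _]] := @functional_branch i (xi_ k); last by exists psi.
  move=> j /Dneq0 /sep[_ /(_ k)]; rewrite -sumD !xi_E /D /= => h.
  by apply: contraNneq h => e; apply/eqP; move: e; lra.
have [||r1 r1_gt0 r1P] := @fin_common_radius R 'I_n (fun k r => forall b : 'rV[R]_n,
    uclose r (b 0) a -> forall x, gaudin_solution (b 0) x -> uclose r x (X i) ->
    \sum_l xi_ k l * x l = \sum_l xi_ k l * X i l + psi k b).
- move=> k r r' /andP[_ rr'] h b /(ucloseW rr') br x xsol /(ucloseW rr') xr; exact: h.
- by move=> k; have [_ [r r_gt0 h]] := psiP k; exists r.
pose r := Num.min r0 r1; have r_gt0 : 0 < r by rewrite lt_min r0_gt0.
have rr0 : r <= r0 by rewrite ge_min lexx.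
have rr1 : r <= r1 by rewrite ge_min lexx orbT.
exists r, (fun (b : 'rV[R]_n) k => psi k b - (phi b - X i k)); split; first exact: r_gt0.
- move=> k; have [psi_an _] := psiP k.
  have := analytic_atB psi_an (analytic_atB phi_an (analytic_at_cst (X i k)%:C%C _)).
  by apply: analytic_at_near; apply: filterE => b; rewrite !rmorphB.
- exists r => // b ba x xsol xX; apply/funext => k.
  have := phiP b (ucloseW rr0 ba) x xsol (ucloseW rr0 xX).
  have := r1P k b (ucloseW rr1 ba) x xsol (ucloseW rr1 xX).
  rewrite !xi_E => h1 h2; move: h1; rewrite h2; lra.
(* A root near xi(X i) controls only the xi-value of the new solution. Being near some X j as well,
   with xi-values closer than the separation gap, it must have j = i. *)
move=> e e0; pose S := \sum_k `|xi k|; have S0 : 0 <= S by apply: sumr_ge0.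
pose e' := Num.min e (g / (3 * (S + 1))).
have e'0 : 0 < e' by rewrite lt_min e0 divr_gt0 // mulr_gt0 // ltr_wpDl.
have [r2 r20 near] := solutions_near e'0.
have [|r3 r30 ex] := phi_ex (g / 3); first by rewrite divr_gt0.
exists (Num.min r2 r3); first by rewrite lt_min r20.
move=> b ba; have [|x xsol x_i] := ex b; first by apply: ucloseW ba; rewrite ge_min lexx orbT.
have [|j x_j] := near b _ x xsol; first by apply: ucloseW ba; rewrite ge_min lexx.
suff ji : j = i by exists x => //; rewrite -ji; apply: ucloseW x_j; rewrite ge_min lexx.
apply/Xinj/funext => k; apply/eqP; rewrite -subr_eq0; apply/eqP.
apply: (gP (j, i)); rewrite -sumD.
apply: le_lt_trans (ler_distD (\sum_k xi k * x k) _ _) _.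
have Se : S * e' <= g / 3.
  apply: (@le_trans _ _ (S * (g / (3 * (S + 1))))).
    by rewrite ler_wpM2l // ge_min lexx orbT.
  by rewrite mulrA ler_pdivrMr ?mulr_gt0 ?ltr_wpDl //; lra.
have := functional_uclose xi x_j; rewrite distrC; move: x_i Se; rewrite /S; lra.
Qed.
End Neighbourhood.

(** * Continuation along segments for an abstract solution relation *)

Section Continuation.
Variables (R : realType) (n : nat).
Local Notation point := ('I_n -> R).
Variables (sol : point -> point -> Prop) (Dom : point -> Prop) (a0 x0 : point).
Implicit Types (a b p x y : point) (e r s : R).

Definition ray a s : point := fun k => a0 k + s * (a k - a0 k).

Hypothesis Dom_star : forall a, Dom a -> forall s, 0 <= s <= 1 -> Dom (ray a s).

Definition uniformly_separated r p := forall b, uclose r b p -> forall x y,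
  sol b x -> sol b y -> uclose r x y -> x = y.

Definition uniformly_transported e r p := forall b b', uclose r b p -> uclose r b' p ->
  forall x, sol b x -> exists2 y, sol b' y & uclose e x y.

Hypothesis sol_separated : forall p, Dom p -> exists2 r, 0 < r & uniformly_separated r p.
Hypothesis sol_transported : forall p, Dom p -> forall e, 0 < e ->
  exists2 r, 0 < r & uniformly_transported e r p.
Hypothesis x0_sol : sol a0 x0.

Lemma uclose_trans e e' x y z : uclose e x y -> uclose e' y z -> uclose (e + e') x z.
Proof. by move=> xy yz k; apply: le_lt_trans (ler_distD (y k) _ _) _; apply: ltrD. Qed.

Lemma ray_uclose a r : 0 < r -> exists2 d, 0 < d & forall s s', `|s - s'| < d ->
  uclose r (ray a s) (ray a s').
Proof.
move=> r0; pose B := 1 + \sum_k `|a k - a0 k|.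
have B0 : 0 < B by rewrite ltr_pwDl // sumr_ge0.
exists (r / B); first by rewrite divr_gt0.
move=> s s'; rewrite ltr_pdivlMr // => h k.
rewrite /ray opprD addrACA subrr add0r -mulrBl normrM; apply: le_lt_trans h.
rewrite ler_wpM2l // /B (bigD1 k) //= addrCA lerDl addr_ge0 // sumr_ge0 //.
Qed.

Lemma uniform_on_ray (P : R -> point -> Prop) a : Dom a ->
  (forall r r' p, 0 < r' <= r -> P r p -> P r' p) ->
  (forall p, Dom p -> exists2 r, 0 < r & forall p', uclose r p' p -> P r p') ->
  exists2 r, 0 < r & forall s, 0 <= s <= 1 -> P r (ray a s).
Proof.
move=> Da mono loc.
have /compact_near_coveringP cov : compact `[0 : R, 1]%classic by apply: segment_compact.
(* Compactness of [0, 1] in near-covering form: with the filter of small positive radii, local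
   validity yields one radius for the whole segment. *)
have := cov R (0^'+)%classic (fun r s => P r (ray a s)) _; case.
  move=> s /=; rewrite in_itv /= => s01.
  have [r r0 rP] := loc _ (Dom_star Da s01).
  have [d d0 dP] := ray_uclose a r0.
  exists ([set s' | `|s' - s| < d], [set r' | 0 < r' <= r])%classic => /=.
    split; last by apply: filterS2 (nbhs_right_gt 0) (nbhs_right_le r0) => r' h1 h2 /=; rewrite h1 h2.
    by apply/nbhs_ballP; exists d => // s'; rewrite /ball /= distrC.
  by move=> [s' r'] /= [ss' r'r]; apply: mono r'r _; apply: rP; apply: dP.
move=> d /= d0 h; exists (d / 2); first by rewrite divr_gt0.
move=> s s01; apply: (h (d / 2)); rewrite /= ?in_itv //; last by rewrite divr_gt0.
by rewrite sub0r normrN ger0_norm; lra.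
Qed.

Lemma separatedW r r' p : 0 < r' <= r -> uniformly_separated r p -> uniformly_separated r' p.
Proof.
move=> /andP[_ rr'] sep b bp x y bx yb xy.
exact: (sep b (ucloseW rr' bp) x y bx yb (ucloseW rr' xy)).
Qed.

Lemma transportedW e r r' p : 0 < r' <= r -> uniformly_transported e r p -> uniformly_transported e r' p.
Proof. by move=> /andP[_ rr'] tr b b' /(ucloseW rr') bp /(ucloseW rr') bp'; apply: tr. Qed.

Lemma separated_on_ray a : Dom a -> exists2 r, 0 < r & forall s, 0 <= s <= 1 ->
  uniformly_separated r (ray a s).
Proof.
move=> Da; apply: (uniform_on_ray Da); first exact: separatedW.
move=> p /sol_separated[r r0 sep]; exists (r / 2); first by rewrite divr_gt0.
move=> p' pp' b bp x y bx yb xy; apply: (sep b) => //.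
  by rewrite [r]splitr; apply: uclose_trans bp pp'.
by apply: ucloseW xy; lra.
Qed.

Lemma transported_on_ray a e : Dom a -> 0 < e -> exists2 r, 0 < r & forall s, 0 <= s <= 1 ->
  uniformly_transported e r (ray a s).
Proof.
move=> Da e0; apply: (uniform_on_ray Da); first exact: transportedW.
move=> p /sol_transported/(_ e e0)[r r0 tr]; exists (r / 2); first by rewrite divr_gt0.
move=> p' pp' b b' bp bp'; apply: tr.
  by rewrite [r]splitr; apply: uclose_trans bp pp'.
by rewrite [r]splitr; apply: uclose_trans bp' pp'.
Qed.

Definition ray_point M a i := ray a (i%:R / M%:R).

(* [reach M e a i x]: x is reached from [x0] after i of the M equal steps along the segment
   from [a0] to [a], through solutions that move by less than e at each step. *)
Fixpoint reach (M : nat) e a (i : nat) x : Prop :=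
  if i is j.+1 then sol (ray_point M a j.+1) x /\ exists2 y, reach M e a j y & uclose e y x
  else x = x0.

Lemma ray0 a : ray a 0 = a0.
Proof. by apply/funext => k; rewrite /ray mul0r addr0. Qed.

Lemma ray1 a : ray a 1 = a.
Proof. by apply/funext => k; rewrite /ray mul1r addrC subrK. Qed.

Lemma reach_sol M e a i x : reach M e a i x -> sol (ray_point M a i) x.
Proof.
case: i => [->|i [//]].
by rewrite /ray_point mul0r ray0.
Qed.

Lemma reachW M e e' a i x : e' <= e -> reach M e' a i x -> reach M e a i x.
Proof.
move=> ee'; elim: i x => //= i IH x [xsol [y /IH ya yx]]; split=> //.
by exists y => //; apply: ucloseW yx.
Qed.

(** Every second point of a fine chain is a coarse chain with twice the tolerance; this compares
    successive dyadic subdivisions. *)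
Lemma reach_half M e a i x : reach M.*2 e a i.*2 x -> reach M (e + e) a i x.
Proof.
elim: i x => [//|i IH] x; rewrite doubleS /= => -[xsol [y [_ [z /IH za zy] yx]]].
split; last by exists z => //; apply: uclose_trans zy yx.
move: xsol; rewrite /ray_point -doubleS -!muln2 !natrM.
by rewrite -mulf_div divff ?mulr1 // pnatr_eq0.
Qed.

Lemma step01 M i : (0 < M)%N -> (i <= M)%N -> 0 <= (i%:R / M%:R : R) <= 1.
Proof.
move=> M0 iM; rewrite divr_ge0 ?ler0n //= ler_pdivrMr ?ltr0n // mul1r ler_nat //.
Qed.

Lemma uclose_refl r x : 0 < r -> uclose r x x.
Proof. by move=> r0 k; rewrite subrr normr0. Qed.

(** Two continuations of the same predecessor are within 2 e of each other, below the separation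
    distance. *)
Lemma reach_unique a r M e i x y : (0 < M)%N -> (i <= M)%N -> 0 < r ->
  (forall s, 0 <= s <= 1 -> uniformly_separated r (ray a s)) -> e + e <= r ->
  reach M e a i x -> reach M e a i y -> x = y.
Proof.
move=> M0 + r0 sep er; elim: i x y => [|i IH] x y iM; first by move=> -> ->.
move=> /= [xsol [x' x'a x'x]] [ysol [y' y'a y'y]].
have e' : x' = y' by apply: IH => //; apply: ltnW.
apply: (sep _ (step01 M0 iM) _ (uclose_refl _ r0) _ _ xsol ysol).
apply: ucloseW er _; apply: uclose_trans (uclose_sym x'x) _; by rewrite e'.
Qed.

Lemma reach_exists a e : Dom a -> 0 < e -> exists k0, forall k, (k0 <= k)%N ->
  exists x, reach (2 ^ k) e a (2 ^ k) x.
Proof.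
move=> Da e0; have [r r0 tr] := transported_on_ray Da e0.
have [d d0 dP] := ray_uclose a r0.
have [k0 k0d] := exists_half_pow_lt 1 d0.
exists k0 => k k0k; set M := (2 ^ k)%N.
have M0 : (0 < M)%N by rewrite expn_gt0.
have Md : M%:R^-1 < d.
  apply: le_lt_trans k0d; rewrite mul1r /M natrX lef_pV2 ?posrE ?exprn_gt0 //.
  by rewrite ler_weXn2l // ler1n.
suff: forall i, (i <= M)%N -> exists x, reach M e a i x by apply.
elim=> [_|i IH iM]; first by exists x0.
have [x xi] := IH (ltnW iM).
have step : uclose r (ray_point M a i.+1) (ray_point M a i).
  apply: dP; rewrite -mulrBl -natrB // subSnn mul1r ger0_norm ?invr_ge0 ?ler0n //.
have [y ysol xy] := tr _ (step01 M0 (ltnW iM)) _ _ (uclose_refl _ r0) step _ (reach_sol xi).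
by exists y; split=> //; exists x.
Qed.

(** Asking for all tolerances and all fine dyadic subdivisions lets continuations to different
    endpoints be compared at a common tolerance and step count. *)
Definition is_continuation a x := forall e, 0 < e -> exists k0, forall k, (k0 <= k)%N ->
  reach (2 ^ k) e a (2 ^ k) x.

Lemma continuation_exists a : Dom a -> exists x, is_continuation a x.
Proof.
move=> Da; have [r r0 sep] := separated_on_ray Da.
(* Halving the number of steps doubles the tolerance and uniqueness needs it twice, hence a
   quarter. *)
pose e1 := r / 4; have e10 : 0 < e1 by rewrite divr_gt0.
have M0 k : (0 < 2 ^ k)%N by rewrite expn_gt0.
have [k1 k1P] := reach_exists Da e10; have [x xk1] := k1P k1 (leqnn _).
have const k : (k1 <= k)%N -> reach (2 ^ k) e1 a (2 ^ k) x.
  move=> /subnK <-; elim: (k - k1)%N => [//|j IH]; rewrite addSn.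
  have [y yj] := k1P (j + k1).+1 (leq_trans (leq_addl _ _) (leqnSn _)).
  suff -> : x = y by [].
  have yj' : reach (2 ^ (j + k1)) (e1 + e1) a (2 ^ (j + k1)) y.
    by apply: reach_half; rewrite -!mul2n -expnS.
  apply: (reach_unique (M0 _) (leqnn _) r0 sep _ (reachW _ IH) yj'); rewrite /e1; lra.
exists x => e e0; pose e' := Num.min e e1.
have e'0 : 0 < e' by rewrite lt_min e0.
have e'e : e' <= e by rewrite ge_min lexx.
have e'e1 : e' <= e1 by rewrite ge_min lexx orbT.
have [k2 k2P] := reach_exists Da e'0; exists (maxn k1 k2) => k; rewrite geq_max.
move=> /andP[k1k k2k]; have [y yk] := k2P k k2k.
suff -> : x = y by exact: reachW yk.
apply: (reach_unique (M0 _) (leqnn _) r0 sep _ (const k k1k) (reachW e'e1 yk)).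
by rewrite /e1; lra.
Qed.

Lemma continuation_sol a x : is_continuation a x -> sol a x.
Proof.
move=> /(_ 1 ltr01)[k /(_ k (leqnn _)) /reach_sol]; rewrite /ray_point divff ?ray1 //.
by rewrite pnatr_eq0 expn_eq0.
Qed.

Lemma continuation_base : is_continuation a0 x0.
Proof.
move=> e e0; exists 0%N => k _; suff h M i : reach M e a0 i x0 by apply: h.
elim: i => //= i IH.
have -> : ray_point M a0 i.+1 = a0 by apply/funext => l; rewrite /ray_point /ray subrr mulr0 addr0.
by split=> //; exists x0 => //; apply: uclose_refl.
Qed.

(** The chains to a and to b are followed in parallel. At each step the transport of the solution on
    one segment to the other must, by separation, be the solution already chosen there. *)
Lemma continuation_near a x e : Dom a -> is_continuation a x -> 0 < e ->
  exists2 r, 0 < r & forall b y, uclose r b a -> is_continuation b y -> uclose e x y.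
Proof.
move=> Da ax e0; have [r r0 sep] := separated_on_ray Da.
pose e' := Num.min e (r / 4); have e'0 : 0 < e' by rewrite lt_min e0 divr_gt0.
have e'r : e' <= r / 4 by rewrite ge_min lexx orbT.
have [d d0 tr] := transported_on_ray Da e'0.
exists (Num.min r d); first by rewrite lt_min r0.
move=> b y ba yb; have bar : uclose r b a by apply: ucloseW ba; rewrite ge_min lexx.
have bad : uclose d b a by apply: ucloseW ba; rewrite ge_min lexx orbT.
have [k1 k1P] := ax _ e'0; have [k2 k2P] := yb _ e'0.
have := k1P _ (leq_maxl k1 k2); have := k2P _ (leq_maxr k1 k2).
set M := (2 ^ _)%N; have M0 : (0 < M)%N by rewrite expn_gt0.
suff: forall i, (i <= M)%N -> forall u v, reach M e' b i v -> reach M e' a i u -> uclose e' u v.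
  by move=> h yM xM; apply: ucloseW (h M (leqnn _) x y yM xM); rewrite ge_min lexx.
have ray_near s t : 0 <= s <= 1 -> 0 < t -> uclose t b a -> uclose t (ray b s) (ray a s).
  move=> /andP[s0 s1] t0 bat k; rewrite /ray.
  have -> : a0 k + s * (b k - a0 k) - (a0 k + s * (a k - a0 k)) = s * (b k - a k) by ring.
  by rewrite normrM (ger0_norm s0); apply: le_lt_trans (bat k); rewrite ler_piMl.
elim=> [_ u v -> ->|i IH iM u v /= [vsol [v' v'b v'v]] [usol [u' u'a u'u]]].
  exact: uclose_refl.
have u'v' := IH (ltnW iM) u' v' v'b u'a.
have s01 := step01 M0 iM.
have [w wsol uw] := tr _ s01 _ _ (uclose_refl _ d0) (ray_near _ _ s01 d0 bad) _ usol.
suff -> : v = w by [].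
apply: (sep _ s01 _ (ray_near _ _ s01 r0 bar) _ _ vsol wsol).
(* From v to w the path goes through v', u' and u: four moves of less than r / 4. *)
apply: (@ucloseW _ _ _ (e' + (e' + (e' + e')))); first by lra.
apply: uclose_trans (uclose_sym v'v) _; apply: uclose_trans (uclose_sym u'v') _.
exact: uclose_trans u'u uw.
Qed.

Lemma global_continuation : exists X : point -> point,
  [/\ X a0 = x0, forall a, Dom a -> sol a (X a) &
    forall a, Dom a -> forall e, 0 < e -> exists2 r, 0 < r &
      forall b, Dom b -> uclose r b a -> uclose e (X a) (X b)].
Proof.
(* The value at [a0] is prescribed within the choice, which is possible because x0 is a continuation
   to [a0]; outside [Dom] the value is arbitrary. *)
have /choice[X XP] (a : point) : exists x, (Dom a -> is_continuation a x) /\ (a = a0 -> x = x0).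
  have [->|aa0] := pselect (a = a0).
    by exists x0; split=> // _; exact: continuation_base.
  have [Da|nDa] := pselect (Dom a); last by exists x0.
  by have [x ax] := continuation_exists Da; exists x.
exists X; split.
- by have [_] := XP a0; apply.
- by move=> a Da; have [+ _] := XP a => /(_ Da); exact: continuation_sol.
move=> a Da e e0; have [Xa _] := XP a.
have [r r0 h] := continuation_near Da (Xa Da) e0; exists r => // b Db ba.
by have [Xb _] := XP b; apply: h ba (Xb Db).
Qed.
End Continuation.

(** * Increasing parameters and the theorem *)

Lemma is_solutionP (F : numFieldType) n (a x : 'rV[F]_n) :
  is_solution a x <-> gaudin_solution (a 0) (x 0).
Proof.
have e k : \sum_(j < n | j != k) (x 0 j - x 0 k) / (a 0 j - a 0 k) =
    \sum_j gap_inv (a 0) k j * (x 0 k - x 0 j).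
  rewrite [RHS](bigD1 k) //= subrr mulr0 add0r; apply: eq_bigr => j _.
  by rewrite /gap_inv mulrC -[in RHS]mulrNN -invrN !opprB.
by split=> xsol k; rewrite xsol e.
Qed.

Section OrderedPoints.
Variables (R : realType) (n : nat).
Implicit Types (p x : 'I_n -> R).

Definition increasing p := forall i j : 'I_n, (i < j)%N -> p i < p j.

Lemma increasing_inj p : increasing p -> injective p.
Proof.
move=> pinc i j pij; apply/val_inj/eqP; apply: contraT.
by rewrite neq_ltn => /orP[] /pinc; rewrite pij ltxx.
Qed.

Lemma increasing_ray p q s : increasing p -> increasing q -> 0 <= s <= 1 ->
  increasing (ray p q s).
Proof.
move=> pinc qinc /andP[s0 s1] i j ij; rewrite /ray.
have := pinc i j ij; have := qinc i j ij.
rewrite -subr_gt0 => q0; rewrite -subr_gt0 => p0; rewrite -subr_gt0.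
have -> : p j + s * (q j - p j) - (p i + s * (q i - p i)) =
    (1 - s) * (p j - p i) + s * (q j - q i) by ring.
have [->|s_neq1] := eqVneq s 1; first by rewrite subrr mul0r add0r mul1r.
have s1' : 0 < 1 - s by rewrite subr_gt0 lt_neqAle s_neq1.
by rewrite ltr_pwDl ?mulr_gt0 // mulr_ge0 // ltW.
Qed.

Lemma increasing_near p : increasing p -> exists2 r, 0 < r &
  forall q, uclose r q p -> increasing q.
Proof.
move=> pinc; have [||r r0 rP] := @fin_common_radius R ('I_n * 'I_n)%type
    (fun ij e => (ij.1 < ij.2)%N -> 2 * e <= p ij.2 - p ij.1).
- by move=> ij e e' /andP[_ ee'] h /h; lra.
- move=> [i j] /=; have [ij|ij] := boolP (i < j)%N; last by exists 1.
  by exists ((p j - p i) / 2) => [|_]; have := pinc i j ij; lra.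
exists r => // q qp i j ij; have /= := rP (i, j) ij.
have := qp i; have := qp j; rewrite !ltr_norml => /andP[? ?] /andP[? ?]; lra.
Qed.

(** A solution at a nearby point is within s / 2 of some X i, so a second solution close to it is
    within s of the same X i; the branch through X i leaves room for only one. *)
Lemma solution_separated p : injective p ->
  exists2 r, 0 < r & uniformly_separated (@gaudin_solution R n) r p.
Proof.
move=> p_inj; have [X [Xsol _ Xinj Xchar]] := gaudin_spectrum p_inj.
have [||s s0 sP] := @fin_common_radius R _ (fun i e => forall b : 'rV[R]_n, uclose e (b 0) p ->
    forall x y, gaudin_solution (b 0) x -> gaudin_solution (b 0) y ->
    uclose e x (X i) -> uclose e y (X i) -> x = y).
- move=> i e e' /andP[_ ee'] h b /(ucloseW ee') be x y xsol ysol.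
  by move=> /(ucloseW ee') xe /(ucloseW ee'); apply: h.
- move=> i; have [s [phi [s0 _ [r r0 uniq] _]]] := solution_branch p_inj Xchar Xinj i.
  exists (Num.min s r); first by rewrite lt_min s0.
  have ms : Num.min s r <= s by rewrite ge_min lexx.
  have mr : Num.min s r <= r by rewrite ge_min lexx orbT.
  move=> b bp x y xsol ysol xi yi.
  by rewrite (uniq b (ucloseW mr bp) x xsol (ucloseW ms xi))
    (uniq b (ucloseW mr bp) y ysol (ucloseW ms yi)).
have s20 : 0 < s / 2 by rewrite divr_gt0.
have [r r0 near] := solutions_near p_inj Xchar s20.
exists (Num.min r (s / 2)); first by rewrite lt_min r0.
have mr : Num.min r (s / 2) <= r by rewrite ge_min lexx.
have ms : Num.min r (s / 2) <= s / 2 by rewrite ge_min lexx orbT.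
move=> b bp x y xsol ysol xy; have [i xi] := near b (ucloseW mr bp) x xsol.
have bE : (\row_k b k) 0 = b by apply/funext => k; rewrite mxE.
apply: (sP i (\row_k b k)); rewrite ?bE //.
- by apply: ucloseW (ucloseW ms bp); lra.
- by apply: ucloseW xi; lra.
rewrite [s]splitr; apply: uclose_trans _ xi.
by apply: ucloseW ms _; exact: uclose_sym.
Qed.

(** Both solutions are compared with the same X i at the centre p, at distance e / 2 each. *)
Lemma solution_transported p e : injective p -> 0 < e ->
  exists2 r, 0 < r & uniformly_transported (@gaudin_solution R n) e r p.
Proof.
move=> p_inj e0; have [X [_ _ Xinj Xchar]] := gaudin_spectrum p_inj.
have e20 : 0 < e / 2 by rewrite divr_gt0.
have [r1 r10 near] := solutions_near p_inj Xchar e20.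
have [||r2 r20 r2P] := @fin_common_radius R _ (fun i r => forall b, uclose r b p ->
    exists2 x, gaudin_solution b x & uclose (e / 2) x (X i)).
- by move=> i r r' /andP[_ rr'] h b /(ucloseW rr'); apply: h.
- by move=> i; have [s [phi [_ _ _ h]]] := solution_branch p_inj Xchar Xinj i; exact: h.
exists (Num.min r1 r2); first by rewrite lt_min r10.
have m1 : Num.min r1 r2 <= r1 by rewrite ge_min lexx.
have m2 : Num.min r1 r2 <= r2 by rewrite ge_min lexx orbT.
move=> b b' bp b'p x xsol; have [i xi] := near b (ucloseW m1 bp) x xsol.
have [y ysol yi] := r2P i b' (ucloseW m2 b'p); exists y => //.
by rewrite [e]splitr; apply: uclose_trans xi (uclose_sym yi).
Qed.
End OrderedPoints.

Local Open Scope classical_set_scope.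
Local Open Scope ring_scope.

Theorem theorem4 (R : realType) (n : nat) (hn : (1 <= n)%N) :
  (forall a x : 'rV[R[i]]_n,
     injective (fun k : 'I_n => a 0 k) ->
     (forall k : 'I_n, a 0 k \is Num.real) ->
     is_solution a x ->
     forall k : 'I_n, x 0 k \is Num.real)
  /\
  (forall (a0 : 'rV[R]_n) (x0 : 'rV[R[i]]_n),
     ordered_points a0 ->
     is_solution (complex_point a0) x0 ->
     exists X : 'rV[R]_n -> 'rV[R[i]]_n,
       [/\ analytic_on (@ordered_points R n) X,
           X a0 = x0 &
           forall a : 'rV[R]_n, ordered_points a ->
             is_solution (complex_point a) (X a)]).
Proof.
have real_solutions (a x : 'rV[R[i]]_n) : injective (fun k : 'I_n => a 0 k) ->
    (forall k : 'I_n, a 0 k \is Num.real) -> is_solution a x ->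
    forall k : 'I_n, x 0 k \is Num.real.
  move=> a_inj a_real /is_solutionP /(middle_level_exists a_inj a_real)[f [fx f0 _]] k.
  exact: (joint_eigen_real a_real k fx f0).
split=> // a0 x0 Da0 x0sol.
have complexE (b : 'rV[R]_n) : complex_point b 0 = real_complex R \o b 0.
  by apply/funext => k; rewrite /complex_point mxE.
have sol_complex (b : 'rV[R]_n) (x : 'I_n -> R) : gaudin_solution (b 0) x ->
    is_solution (complex_point b) (\row_k (x k)%:C%C).
  move=> xsol; apply/is_solutionP; rewrite complexE.
  have -> : (\row_k (x k)%:C%C) 0 = real_complex R \o x by apply/funext => k; rewrite mxE.
  exact/gaudin_solution_complex.
(* By the first claim x0 is real, so the continuation takes place over R. *)
pose y0 k := complex.Re (x0 0 k).
have x0E k : x0 0 k = (y0 k)%:C%C.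
  rewrite /y0 RRe_real //; apply: real_solutions x0sol k => [k l|k].
    by rewrite !mxE => /complexI /(increasing_inj Da0).
  by rewrite mxE complex_real.
have y0sol : gaudin_solution (a0 0) y0.
  apply/gaudin_solution_complex; rewrite -complexE.
  suff -> : real_complex R \o y0 = x0 0 by apply/is_solutionP.
  by apply/funext => k; rewrite x0E.
have [X [Xa0 Xsol Xcont]] := @global_continuation R n (@gaudin_solution R n) (@increasing R n)
  (a0 0) y0 (fun q Dq s => increasing_ray Da0 Dq)
  (fun p Dp => solution_separated (increasing_inj Dp))
  (fun p Dp e => solution_transported (increasing_inj Dp)) y0sol.
exists (fun b => \row_k (X (b 0) k)%:C%C); split; last 2 first.
- by apply/rowP => k; rewrite mxE Xa0 x0E.
- by move=> a Da; apply: sol_complex; apply: Xsol.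
move=> k a Da; have Dinc : increasing (a 0) := Da.
have p_inj := increasing_inj Dinc.
(* Near a, continuity keeps the continued solution within s of its value Y i at a, so it coincides
   with the analytic branch through Y i. *)
have [Y [_ Yall Yinj Ychar]] := gaudin_spectrum p_inj.
have [i Xi] := Yall _ (Xsol _ Dinc).
have [s [phi [s0 phi_an [r1 r10 uniq] _]]] := solution_branch p_inj Ychar Yinj i.
have [r2 r20 inc] := increasing_near Dinc.
have [r3 r30 cont] := Xcont _ Dinc s s0.
have := phi_an k; rewrite (_ : \row_l a 0 l = a); last by apply/rowP => l; rewrite mxE.
apply: analytic_at_near; apply/near_rowP.
exists (Num.min r1 (Num.min r2 r3)); first by rewrite !lt_min r10 r20.
move=> b ba; rewrite mxE; congr (_%:C%C).
have b1 : uclose r1 (b 0) (a 0) by apply: ucloseW ba; rewrite ge_min lexx.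
have b2 : uclose r2 (b 0) (a 0) by apply: ucloseW ba; rewrite !ge_min lexx orbT.
have b3 : uclose r3 (b 0) (a 0) by apply: ucloseW ba; rewrite !ge_min lexx !orbT.
have Db := inc _ b2; rewrite -(uniq b b1 _ (Xsol _ Db)) // -Xi.
exact/uclose_sym/cont.
Qed.
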